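(* Let $X\in\mathcal{C}_1$ be a circular graph containing at least one particle of each type, i.e. there is a vertex $u$ of $X$ with $a_1(u)=1$ and there is a vertex $v$ of $X$ with $b_1(v)=1$. Then the sequence $\left(|V((\sqrt{\tau}\,I)^{-n}(X))|\right)_{n\in\mathbb{N}}$ is $\Theta(n)$.
   Context: Names. Let $\mathbb{K}$ be a countable set. Names are terms $u,v ::= c \mid u.t \mid u\vee v$ with $c\in\mathbb{K}$, $t\in\{l,r\}^*$, modulo the equalities $(u\vee v).l=u$, $(u\vee v).r=v$, $u.\varepsilon=u$, $u.l\vee u.r=u$ ($\varepsilon$ the empty word). Circular graphs. An element $X$ of $\mathcal{C}_1$ consists of a finite nonempty set $V(X)$ of names such that for all $v,v'\in V(X)$ and $t,t'\in\{l,r\}^*$, $v.t=v'.t'$ implies $v=v'$ and $t=t'$; a set $E(X)$ of edges; and two bits $a_1(u),b_1(u)\in\{0,1\}$ for each vertex $u$. Each vertex $u$ has two ports $u:a$ and $u:b$; each edge has the form $\{u:b,v:a\}$, every port of every vertex belongs to exactly one edge, and the graph is connected, i.e. it is a single finite cycle (a one-vertex cycle has the single edge $\{u:b,u:a\}$). If $\{u:b,v:a\}\in E(X)$, think of $v$ as the right neighbour of $u$. The bit $a_1(u)=1$ (resp. $b_1(u)=1$) means that $u$ contains a particle about to move along port $a$ (resp. port $b$); these are the two types of particles. Step $\sqrt{\tau}$ (each particle hops by half an edge along its port; edges become vertices and vertices become edges). $V(\sqrt{\tau}(X))=\{u.r\vee v.l \mid \{u:b,v:a\}\in E(X)\}$;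 for each $u\in V(X)$ with right neighbour $x$ and left neighbour $y$ (i.e. $\{u:b,x:a\},\{y:b,u:a\}\in E(X)$), there is an edge $\{y':b,x':a\}$ with $y'=y.r\vee u.l$ and $x'=u.r\vee x.l$; and the vertex $x'=u.r\vee v.l$ coming from the edge $\{u:b,v:a\}$ has bits $b_1(x')=b_1(u)$ and $a_1(x')=a_1(v)$. This is a bijection of $\mathcal{C}_1$, with $\sqrt{\tau}^{-1}=T\sqrt{\tau}T$ where $T$ exchanges the bits $a_1(u)$ and $b_1(u)$ at every vertex $u$. Step $I$. Synchronously everywhere in the graph: (split) every vertex $u$ with $a_1(u)=b_1(u)=1$ is replaced by two vertices $u.l,u.r$ joined by the edge $\{u.l:b,u.r:a\}$, where $u.l$ inherits the connection of port $a$ of $u$ and $u.r$ inherits the connection of port $b$ of $u$, with $a_1(u.l)=b_1(u.r)=1$ and $b_1(u.l)=a_1(u.r)=0$; (merge) every pair of vertices $u,v$ with $\{u:b,v:a\}\in E(X)$, $a_1(u)=b_1(v)=1$ and $b_1(u)=a_1(v)=0$ is replaced by one vertex $u\vee v$ with $a_1(u\vee v)=b_1(u\vee v)=1$, which inherits the connection of port $a$ of $u$ and the connection of port $b$ of $v$. Everything else is unchanged. These patterns do not overlap, and $I$ is an involution. $\sqrt{\tau}\,I$ is the composition applying $I$ first and then $\sqrt{\tau}$, so $(\sqrt{\tau}\,I)^{-1}=I^{-1}\sqrt{\tau}^{-1}=I\sqrt{\tau}^{-1}$, and $(\sqrt{\tau}\,I)^{-n}$ is its $n$-th iterate. For real sequences,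 $(u_n)=\Theta((v_n))$ means that there exist positive reals $a,b$ and $n_0\in\mathbb{N}$ such that for all $n\ge n_0$, $a\,v_n\le u_n\le b\,v_n$; ''$\Theta(n)$'' is the case $v_n=n$. *)

(* Defs.v *)
From HB Require Import structures.
From mathcomp Require Import all_boot all_order all_algebra.
From mathcomp Require Import generic_quotient finmap.
From mathcomp Require Import boolp reals.

Set Implicit Arguments.
Unset Strict Implicit.
Unset Printing Implicit Defensive.

Local Open Scope quotient_scope.
Local Open Scope fset_scope.

Inductive letter : Type := lt_l | lt_r.

Inductive term (K : Type) : Type :=
| Atom of K
| Dot of term K & seq letter
| Vee of term K & term K.

(* The congruence generated by the four equalities on names.
   [te_dot_cat] is the convention that makes u.t meaningful for a word t:
   applying the word t ++ t' is applying t and then t'. *)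
Inductive term_eq (K : Type) : term K -> term K -> Prop :=
| te_refl u : term_eq u u
| te_sym u v : term_eq u v -> term_eq v u
| te_trans u v w : term_eq u v -> term_eq v w -> term_eq u w
| te_dot u u' t : term_eq u u' -> term_eq (Dot u t) (Dot u' t)
| te_vee u u' v v' :
    term_eq u u' -> term_eq v v' -> term_eq (Vee u v) (Vee u' v')
| te_vee_l u v : term_eq (Dot (Vee u v) [:: lt_l]) u
| te_vee_r u v : term_eq (Dot (Vee u v) [:: lt_r]) v
| te_dot_nil u : term_eq (Dot u [::]) u
| te_dot_vee u : term_eq (Vee (Dot u [:: lt_l]) (Dot u [:: lt_r])) u
| te_dot_cat u t t' : term_eq (Dot (Dot u t) t') (Dot u (t ++ t')).

HB.instance Definition _ (K : Type) := gen_eqMixin (term K).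
HB.instance Definition _ (K : Type) := gen_choiceMixin (term K).

Definition term_eqb (K : Type) : rel (term K) := fun u v => `[< term_eq u v >].

Lemma term_eqb_refl (K : Type) : reflexive (@term_eqb K).
Proof. by move=> u; apply/asboolP; exact: te_refl. Qed.

Lemma term_eqb_sym (K : Type) : symmetric (@term_eqb K).
Proof. by move=> u v; apply/asboolP/asboolP; exact: te_sym. Qed.

Lemma term_eqb_trans (K : Type) : transitive (@term_eqb K).
Proof.
by move=> v u w /asboolP uv /asboolP vw; apply/asboolP; exact: te_trans uv vw.
Qed.

Canonical term_equiv (K : Type) : equiv_rel (term K) :=
  EquivRel (@term_eqb K) (@term_eqb_refl K) (@term_eqb_sym K)
           (@term_eqb_trans K).

Definition name (K : Type) : Type := {eq_quot (term_equiv K)}.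
HB.instance Definition _ (K : Type) := Choice.on (name K).
HB.instance Definition _ (K : Type) := EqQuotient.on (name K).

Definition atom (K : Type) (c : K) : name K := \pi_(name K) (Atom c).
Definition dot (K : Type) (x : name K) (t : seq letter) : name K :=
  \pi_(name K) (Dot (repr x) t).
Definition vee (K : Type) (x y : name K) : name K :=
  \pi_(name K) (Vee (repr x) (repr y)).
Definition nl (K : Type) (x : name K) : name K := dot x [:: lt_l].
Definition nr (K : Type) (x : name K) : name K := dot x [:: lt_r].

Section NameTheory.
Context {K : Type}.
Implicit Types (x y : name K) (t : seq letter).

Lemma pi_nameP (u v : term K) :
  \pi_(name K) u = \pi_(name K) v <-> term_eq u v.
Proof.
by split=> [/eqmodP/asboolP //|h]; apply/eqmodP/asboolP.
Qed.

Lemma repr_piP (u : term K) : term_eq (repr (\pi_(name K) u)) u.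
Proof. by apply/pi_nameP; rewrite reprK. Qed.

Lemma pi_dot (u : term K) t : \pi_(name K) (Dot u t) = dot (\pi_(name K) u) t.
Proof. by apply/pi_nameP/te_sym/te_dot/repr_piP. Qed.

Lemma pi_vee (u v : term K) :
  \pi_(name K) (Vee u v) = vee (\pi_(name K) u) (\pi_(name K) v).
Proof. by apply/pi_nameP/te_sym/te_vee; exact: repr_piP. Qed.

Lemma dot_nil x : dot x [::] = x.
Proof. by rewrite -[RHS]reprK; apply/pi_nameP/te_dot_nil. Qed.

Lemma dot_cat x t t' : dot (dot x t) t' = dot x (t ++ t').
Proof.
rewrite -(reprK x); move: (repr x) => u {x}.
by rewrite -(pi_dot u t) -!pi_dot; apply/pi_nameP/te_dot_cat.
Qed.

Lemma nl_vee x y : nl (vee x y) = x.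
Proof.
rewrite -(reprK x) -(reprK y); move: (repr x) (repr y) => u v {x y}.
by rewrite /nl -pi_vee -pi_dot; apply/pi_nameP/te_vee_l.
Qed.

Lemma nr_vee x y : nr (vee x y) = y.
Proof.
rewrite -(reprK x) -(reprK y); move: (repr x) (repr y) => u v {x y}.
by rewrite /nr -pi_vee -pi_dot; apply/pi_nameP/te_vee_r.
Qed.

Lemma vee_nlnr x : vee (nl x) (nr x) = x.
Proof.
rewrite -(reprK x); move: (repr x) => u {x}.
by rewrite /nl /nr -!pi_dot -pi_vee; apply/pi_nameP/te_dot_vee.
Qed.

Lemma vee_inj x y x' y' : vee x y = vee x' y' -> x = x' /\ y = y'.
Proof.
by move=> e; split; [rewrite -(nl_vee x y) e nl_vee|rewrite -(nr_vee x y) e nr_vee].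
Qed.

Lemma dot_nl x t : dot (nl x) t = dot x (lt_l :: t).
Proof. by rewrite dot_cat. Qed.

Lemma dot_nr x t : dot (nr x) t = dot x (lt_r :: t).
Proof. by rewrite dot_cat. Qed.

Lemma dot_vee_l x y t : dot (vee x y) (lt_l :: t) = dot x t.
Proof. by rewrite -dot_nl nl_vee. Qed.

Lemma dot_vee_r x y t : dot (vee x y) (lt_r :: t) = dot y t.
Proof. by rewrite -dot_nr nr_vee. Qed.

End NameTheory.

(* [(u, v) \in E X] is the edge {u:b, v:a}; [u \in a1 X] and [u \in b1 X] mean
   that the bits a_1(u) and b_1(u) equal 1. *)
Record graph (K : Type) : Type := Graph {
  V  : {fset name K};
  E  : {fset name K * name K};
  a1 : {fset name K};
  b1 : {fset name K} }.

Definition adj (K : Type) (X : graph K) : rel (name K) :=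
  fun u v => ((u, v) \in E X) || ((v, u) \in E X).

Definition connected (K : Type) (X : graph K) : Prop :=
  forall u v, u \in V X -> v \in V X ->
    exists2 p, path (adj X) u p & last u p = v.

Record C1 (K : Type) (X : graph K) : Prop := IsC1 {
  C1_nonempty : V X != fset0;
  C1_names : forall v v' t t', v \in V X -> v' \in V X ->
    dot v t = dot v' t' -> v = v' /\ t = t';
  C1_edge : forall u v, (u, v) \in E X -> u \in V X /\ v \in V X;
  C1_portb : forall u, u \in V X -> exists! v, (u, v) \in E X;
  C1_porta : forall v, v \in V X -> exists! u, (u, v) \in E X;
  C1_connected : connected X;
  C1_a1 : a1 X `<=` V X;
  C1_b1 : b1 X `<=` V X }.

(* the vertex u.r \/ v.l created from the edge {u:b, v:a} *)
Definition mid (K : Type) (e : name K * name K) : name K :=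
  vee (nr e.1) (nl e.2).

(* A vertex with left neighbour y and right neighbour x is a pair of edges
   e = (y, u), e' = (u, x); it gives the edge (mid e, mid e'). *)
Definition sqrt_tau (K : Type) (X : graph K) : graph K := {|
  V  := [fset mid e | e in E X];
  E  := [fset (mid e, mid e') | e in E X, e' in E X & e.2 == e'.1];
  a1 := [fset mid e | e in E X & e.2 \in a1 X];
  b1 := [fset mid e | e in E X & e.1 \in b1 X] |}.

Definition swap_bits (K : Type) (X : graph K) : graph K :=
  {| V := V X; E := E X; a1 := b1 X; b1 := a1 X |}.

Definition sqrt_tau_inv (K : Type) (X : graph K) : graph K :=
  swap_bits (sqrt_tau (swap_bits X)).

Section StepI.
Context {K : Type} (X : graph K).

(* the neighbours of u, uniquely determined when X is in C1 and u is a vertex;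
   the default value u is then never used *)
Definition rneigh (u : name K) : name K :=
  head u [seq e.2 | e <- enum_fset (E X) & e.1 == u].
Definition lneigh (u : name K) : name K :=
  head u [seq e.1 | e <- enum_fset (E X) & e.2 == u].

Definition split : {fset name K} := a1 X `&` b1 X.

Definition merging : {fset name K * name K} :=
  [fset e in E X | [&& e.1 \in a1 X, e.2 \in b1 X,
                       e.1 \notin b1 X & e.2 \notin a1 X]].

Definition mergel : {fset name K} := [fset e.1 | e in merging].
Definition merger : {fset name K} := [fset e.2 | e in merging].

Definition kept : {fset name K} := V X `\` (split `|` mergel `|` merger).

(* the vertex which, after the step, carries the connection that port a
   (resp. port b) of u had; for an edge of [merging] the connection between
   its ends disappears, so portb and porta are not used for it *)
Definition porta (u : name K) : name K :=
  if u \in split then nl u else if u \in mergel then vee u (rneigh u) else u.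
Definition portb (u : name K) : name K :=
  if u \in split then nr u else if u \in merger then vee (lneigh u) u else u.

Definition Istep : graph K := {|
  V  := kept `|` [fset nl u | u in split] `|` [fset nr u | u in split]
        `|` [fset vee e.1 e.2 | e in merging];
  E  := [fset (portb e.1, porta e.2) | e in E X `\` merging]
        `|` [fset (nl u, nr u) | u in split];
  a1 := (a1 X `&` kept) `|` [fset nl u | u in split]
        `|` [fset vee e.1 e.2 | e in merging];
  b1 := (b1 X `&` kept) `|` [fset nr u | u in split]
        `|` [fset vee e.1 e.2 | e in merging] |}.

End StepI.

Definition step (K : Type) (X : graph K) : graph K := sqrt_tau (Istep X).

(* On C1 this is the inverse of [step]: see [stepK] and [step_invK]. *)
Definition step_inv (K : Type) (X : graph K) : graph K :=
  Istep (sqrt_tau_inv X).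

Definition Theta (R : realType) (u v : nat -> R) : Prop :=
  exists a b : R, exists n0 : nat, [/\ (0 < a)%R, (0 < b)%R &
    forall n, (n0 <= n)%N -> (a * v n <= u n <= b * v n)%R].

Section Basics.
Context {K : Type}.
Implicit Types X : graph K.

Lemma graph_eq X Y : V X = V Y -> E X = E Y -> a1 X = a1 Y -> b1 X = b1 Y ->
  X = Y.
Proof. by case: X => ????; case: Y => ???? /= -> -> -> ->. Qed.

Definition conn X u v := exists2 p, path (adj X) u p & last u p = v.

Lemma conn_refl X u : conn X u u.
Proof. by exists [::]. Qed.

Lemma conn_trans X v u w : conn X u v -> conn X v w -> conn X u w.
Proof.
move=> [p pp <-] [q pq <-]; exists (p ++ q); last by rewrite last_cat.
by rewrite cat_path pp.
Qed.

Lemma conn_edge X u v : (u, v) \in E X -> conn X u v.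
Proof. by move=> h; exists [:: v] => //=; rewrite /adj h. Qed.

Lemma adj_sym X : symmetric (adj X).
Proof. by move=> u v; rewrite /adj orbC. Qed.

Lemma conn_sym X u v : conn X u v -> conn X v u.
Proof.
move=> [p pp <-]; elim: p u pp => [|w p IHp] u /=; first by exists [::].
move=> /andP[uw pp]; apply: conn_trans (IHp _ pp) _.
by exists [:: u] => //=; rewrite adj_sym uw.
Qed.

(* A map f such that the ends of every edge have connected images. *)
Lemma conn_map X Y (f : name K -> name K) :
  (forall u v, (u, v) \in E X -> conn Y (f u) (f v)) ->
  forall u v, conn X u v -> conn Y (f u) (f v).
Proof.
move=> H u v [p pp <-]; elim: p u pp => [|w p IHp] u /=.
  by move=> _; exact: conn_refl.
move=> /andP[/orP[uw|wu] pp]; apply: conn_trans (IHp _ pp); first exact: H.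
by apply: conn_sym; exact: H.
Qed.

Lemma edgeb X u v v' : C1 X -> (u, v) \in E X -> (u, v') \in E X -> v = v'.
Proof.
move=> hX uv uv'; have [uV _] := C1_edge hX uv.
by have [w [_ hw]] := C1_portb hX uV; rewrite -(hw _ uv) -(hw _ uv').
Qed.

Lemma edgea X u u' v : C1 X -> (u, v) \in E X -> (u', v) \in E X -> u = u'.
Proof.
move=> hX uv uv'; have [_ vV] := C1_edge hX uv.
by have [w [_ hw]] := C1_porta hX vV; rewrite -(hw _ uv) -(hw _ uv').
Qed.

Lemma right_edge X u : C1 X -> u \in V X -> (u, rneigh X u) \in E X.
Proof.
move=> hX uV; have [v [uv _]] := C1_portb hX uV; rewrite /rneigh.
set s := [seq _ <- _ | _]; have : (u, v) \in s by rewrite mem_filter /= eqxx.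
have : forall e, e \in s -> e.1 = u /\ e \in E X.
  by move=> e; rewrite mem_filter => /andP[/eqP].
case: s => [|[x y] s] //= H _.
by have [/= <-] := H _ (mem_head _ _).
Qed.

Lemma left_edge X u : C1 X -> u \in V X -> (lneigh X u, u) \in E X.
Proof.
move=> hX uV; have [v [uv _]] := C1_porta hX uV; rewrite /lneigh.
set s := [seq _ <- _ | _]; have : (v, u) \in s by rewrite mem_filter /= eqxx.
have : forall e, e \in s -> e.2 = u /\ e \in E X.
  by move=> e; rewrite mem_filter => /andP[/eqP].
case: s => [|[x y] s] //= H _.
by have [/= <-] := H _ (mem_head _ _).
Qed.

Lemma rightP X u v : C1 X -> (u, v) \in E X -> rneigh X u = v.
Proof.
move=> hX uv; have [uV _] := C1_edge hX uv.
exact: edgeb hX (right_edge hX uV) uv.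
Qed.

Lemma leftP X u v : C1 X -> (u, v) \in E X -> lneigh X v = u.
Proof.
move=> hX uv; have [_ vV] := C1_edge hX uv.
exact: edgea hX (left_edge hX vV) uv.
Qed.

Lemma swap_bitsK : involutive (@swap_bits K).
Proof. by case. Qed.

Lemma swap_bits_C1 X : C1 X -> C1 (swap_bits X).
Proof. by case=> *; split. Qed.

End Basics.

Section SqrtTau.
Context {K : Type} (X : graph K) (hX : C1 X).

Lemma sqrt_tau_VP x :
  reflect (exists2 e, e \in E X & x = mid e) (x \in V (sqrt_tau X)).
Proof. by apply: (iffP (imfsetP _ _ _ _)) => -[e eE ->]; exists e. Qed.

Lemma sqrt_tau_EP x y :
  reflect (exists u v w, [/\ (u, v) \in E X, (v, w) \in E X,
                             x = mid (u, v) & y = mid (v, w)])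
          ((x, y) \in E (sqrt_tau X)).
Proof.
apply: (iffP idP) => [/imfset2P|].
  move=> [[u v] /= uv [[v' w]]]; rewrite !inE /= => /andP[vw /eqP vv'] [-> ->].
  by subst v'; exists u, v, w.
move=> [u [v [w [uv vw -> ->]]]]; apply/imfset2P.
by exists (u, v) => //; exists (v, w) => //; rewrite !inE /= vw eqxx.
Qed.

Lemma mid_inj (e e' : name K * name K) : mid e = mid e' -> nr e.1 = nr e'.1 /\ nl e.2 = nl e'.2.
Proof. exact: vee_inj. Qed.

Lemma mid_injE e e' : e \in E X -> e' \in E X -> mid e = mid e' -> e = e'.
Proof.
case: e e' => [u v] [u' v'] uv uv' /mid_inj[/= h1 h2].
have [uV vV] := C1_edge hX uv; have [uV' vV'] := C1_edge hX uv'.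
by have [-> _] := C1_names hX uV uV' h1; have [-> _] := C1_names hX vV vV' h2.
Qed.

Lemma sqrt_tau_C1 : C1 (sqrt_tau X).
Proof.
have midV u v : (u, v) \in E X -> mid (u, v) \in V (sqrt_tau X).
  by move=> uv; apply/sqrt_tau_VP; exists (u, v).
have conn_mid u v w : (u, v) \in E X -> (v, w) \in E X ->
    conn (sqrt_tau X) (mid (u, v)) (mid (v, w)).
  by move=> uv vw; apply: conn_edge; apply/sqrt_tau_EP; exists u, v, w.
split.
- have /fset0Pn[u uV] := C1_nonempty hX.
  by apply/fset0Pn; exists (mid (u, rneigh X u)); apply: midV; exact: right_edge.
- have key v v' d t d' t' : v \in V (sqrt_tau X) -> v' \in V (sqrt_tau X) ->
      dot v (d :: t) = dot v' (d' :: t') -> v = v' /\ d :: t = d' :: t'.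
    move=> /sqrt_tau_VP[[u w] uw ->] /sqrt_tau_VP[[u' w'] uw' ->].
    have [uV wV] := C1_edge hX uw; have [uV' wV'] := C1_edge hX uw'.
    case: d; case: d'; rewrite ?dot_vee_l ?dot_vee_r /= ?dot_nl ?dot_nr => h.
    + have [? [->]] := C1_names hX uV uV' h; subst u'.
      by rewrite (edgeb hX uw uw').
    + by have [? []] := C1_names hX uV wV' h.
    + by have [? []] := C1_names hX wV uV' h.
    + have [? [->]] := C1_names hX wV wV' h; subst w'.
      by rewrite (edgea hX uw uw').
  move=> v v' t t' vV vV' h.
  have : dot v (rcons t lt_l) = dot v' (rcons t' lt_l).
    by rewrite -!cats1 -!dot_cat h.
  case ht: (rcons t lt_l) => [|d s]; first by case: (t) ht.
  case ht': (rcons t' lt_l) => [|d' s']; first by case: (t') ht'.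
  move=> /(key _ _ _ _ _ _ vV vV')[-> e]; split=> //.
  by move: ht ht'; rewrite e => <- /rcons_inj[].
- by move=> x y /sqrt_tau_EP[u [v [w [uv vw -> ->]]]]; split; apply: midV.
- move=> x /sqrt_tau_VP[[u v] uv ->]; have [_ vV] := C1_edge hX uv.
  exists (mid (v, rneigh X v)); split.
    by apply/sqrt_tau_EP; exists u, v, (rneigh X v); split=> //; exact: right_edge.
  move=> y /sqrt_tau_EP[u' [v' [w' [uv' vw' /(mid_injE uv uv')[_ ?] ->]]]].
  by subst v'; rewrite (rightP hX vw').
- move=> x /sqrt_tau_VP[[u v] uv ->]; have [uV _] := C1_edge hX uv.
  exists (mid (lneigh X u, u)); split.
    by apply/sqrt_tau_EP; exists (lneigh X u), u, v; split=> //; exact: left_edge.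
  move=> y /sqrt_tau_EP[u' [v' [w' [uv' vw' -> /(mid_injE uv vw')[? _]]]]].
  by subst v'; rewrite (leftP hX uv').
- move=> x y /sqrt_tau_VP[[u v] uv ->] /sqrt_tau_VP[[u' v'] uv' ->].
  have [uV _] := C1_edge hX uv; have [uV' _] := C1_edge hX uv'.
  rewrite -(rightP hX uv) -(rightP hX uv').
  apply: (@conn_map _ X _ (fun u => mid (u, rneigh X u))); last first.
    exact: C1_connected.
  move=> a b ab; have [aV bV] := C1_edge hX ab.
  by rewrite (rightP hX ab); apply: conn_mid => //; exact: right_edge.
- apply/fsubsetP => x /imfsetP[e /=]; rewrite !inE /= => /andP[eE _] ->.
  by apply/sqrt_tau_VP; exists e.
- apply/fsubsetP => x /imfsetP[e /=]; rewrite !inE /= => /andP[eE _] ->.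
  by apply/sqrt_tau_VP; exists e.
Qed.

Lemma sqrt_tau_a1P e : e \in E X -> (mid e \in a1 (sqrt_tau X)) = (e.2 \in a1 X).
Proof.
move=> eE; apply/imfsetP/idP => [[e' /=]|h].
  by rewrite !inE /= => /andP[eE' h] /(mid_injE eE eE') ->.
by exists e => //=; rewrite !inE eE.
Qed.

Lemma sqrt_tau_b1P e : e \in E X -> (mid e \in b1 (sqrt_tau X)) = (e.1 \in b1 X).
Proof.
move=> eE; apply/imfsetP/idP => [[e' /=]|h].
  by rewrite !inE /= => /andP[eE' h] /(mid_injE eE eE') ->.
by exists e => //=; rewrite !inE eE.
Qed.

End SqrtTau.

Lemma mid_mid (K : Type) (u v w : name K) : mid (mid (u, v), mid (v, w)) = v.
Proof. by rewrite /mid /= nr_vee nl_vee vee_nlnr. Qed.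

Lemma sqrt_tauTK (K : Type) (X : graph K) : C1 X ->
  swap_bits (sqrt_tau (swap_bits (sqrt_tau X))) = X.
Proof.
move=> hX; set Y := swap_bits (sqrt_tau X).
have hY : C1 Y by apply: swap_bits_C1; exact: sqrt_tau_C1.
have EY x y : reflect (exists u v w, [/\ (u, v) \in E X, (v, w) \in E X,
    x = mid (u, v) & y = mid (v, w)]) ((x, y) \in E Y) by exact: sqrt_tau_EP.
have EYin u v w : (u, v) \in E X -> (v, w) \in E X ->
    (mid (u, v), mid (v, w)) \in E Y by move=> uv vw; apply/EY; exists u, v, w.
have vE v : v \in V X -> exists u w, (u, v) \in E X /\ (v, w) \in E X.
  move=> vV; exists (lneigh X v), (rneigh X v).
  by split; [exact: left_edge|exact: right_edge].
apply: graph_eq.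
- rewrite -[LHS]/(V (sqrt_tau Y)).
  apply/fsetP => v; apply/sqrt_tau_VP/idP => [[[x y] /EY[u [v' [w]]]]|vV].
    by move=> [uv _ -> ->] ->; rewrite mid_mid; have [] := C1_edge hX uv.
  have [u [w [uv vw]]] := vE v vV.
  by exists (mid (u, v), mid (v, w)); [exact: EYin|rewrite mid_mid].
- rewrite -[LHS]/(E (sqrt_tau Y)).
  apply/fsetP => -[v w]; apply/sqrt_tau_EP/idP.
    move=> [x [y [z [/EY[u1 [u2 [u3 [e1 e2 -> ->]]]] /EY[u4 [u5 [u6]]]]]]].
    move=> [e4 e5 /(mid_injE hX e2 e4)[? ?] ->]; subst u4 u5.
    by rewrite !mid_mid => -> ->.
  move=> vw; have [vV wV] := C1_edge hX vw.
  have [u [_ [uv _]]] := vE v vV; have [_ [x [_ wx]]] := vE w wV.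
  exists (mid (u, v)), (mid (v, w)), (mid (w, x)).
  by rewrite !mid_mid; split=> //; exact: EYin.
- apply/fsetP => v; apply/idP/idP => [/imfsetP[[x y] /=]|va].
    rewrite !inE => /andP[/EY[u [v' [w [uv vw -> ->]]]]].
    by rewrite /= sqrt_tau_a1P //= => h ->; rewrite mid_mid.
  have [u [w [uv vw]]] := vE v (fsubsetP (C1_a1 hX) v va).
  apply/imfsetP; exists (mid (u, v), mid (v, w)); last by rewrite mid_mid.
  by rewrite !inE EYin //= sqrt_tau_a1P.
- apply/fsetP => v; apply/idP/idP => [/imfsetP[[x y] /=]|va].
    rewrite !inE => /andP[/EY[u [v' [w [uv vw -> ->]]]]].
    by rewrite /= sqrt_tau_b1P //= => h ->; rewrite mid_mid.
  have [u [w [uv vw]]] := vE v (fsubsetP (C1_b1 hX) v va).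
  apply/imfsetP; exists (mid (u, v), mid (v, w)); last by rewrite mid_mid.
  by rewrite !inE EYin //= sqrt_tau_b1P.
Qed.

Lemma sqrt_tauK (K : Type) (X : graph K) : C1 X -> sqrt_tau_inv (sqrt_tau X) = X.
Proof. exact: sqrt_tauTK. Qed.

Lemma sqrt_tau_inv_C1 (K : Type) (X : graph K) : C1 X -> C1 (sqrt_tau_inv X).
Proof. by move=> hX; apply/swap_bits_C1/sqrt_tau_C1/swap_bits_C1. Qed.

Lemma sqrt_tau_invK (K : Type) (X : graph K) :
  C1 X -> sqrt_tau (sqrt_tau_inv X) = X.
Proof.
move=> hX; have := sqrt_tauTK (swap_bits_C1 hX); rewrite -/(sqrt_tau_inv X).
by move=> /(congr1 (@swap_bits K)); rewrite !swap_bitsK.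
Qed.

Section StepITheory.
Context {K : Type} (X : graph K) (hX : C1 X).

Let Y := Istep X.

Lemma mergingP u v : reflect
  [/\ (u, v) \in E X, u \in a1 X, v \in b1 X, u \notin b1 X & v \notin a1 X]
  ((u, v) \in merging X).
Proof.
by rewrite !inE /=; apply: (iffP andP) => [[-> /and4P[]]|[? -> -> -> ->]].
Qed.

Lemma mergelP u : reflect (exists v, (u, v) \in merging X) (u \in mergel X).
Proof.
apply: (iffP (imfsetP _ _ _ _)) => [[[a b] /= h ->]|[v h]]; first by exists b.
by exists (u, v).
Qed.

Lemma mergerP v : reflect (exists u, (u, v) \in merging X) (v \in merger X).
Proof.
apply: (iffP (imfsetP _ _ _ _)) => [[[a b] /= h ->]|[u h]]; first by exists a.
by exists (u, v).
Qed.

Lemma merging_E u v : (u, v) \in merging X -> (u, v) \in E X.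
Proof. by case/mergingP. Qed.

Lemma splitV u : u \in split X -> u \in V X.
Proof. by rewrite inE => /andP[/(fsubsetP (C1_a1 hX))]. Qed.

Lemma keptV u : u \in kept X -> u \in V X.
Proof. by rewrite inE => /andP[]. Qed.

Lemma mergingV u v : (u, v) \in merging X -> u \in V X /\ v \in V X.
Proof. by move=> /merging_E; exact: C1_edge. Qed.

Variant kind_spec u : Prop :=
| KKept of u \in kept X
| KSplit of u \in split X
| KMergel v of (u, v) \in merging X
| KMerger w of (w, u) \in merging X.

Lemma kindP u : u \in V X -> kind_spec u.
Proof.
move=> uV; case us: (u \in split X); first exact: KSplit.
case ul: (u \in mergel X); first by case/mergelP: ul => v; exact: KMergel.
case ur: (u \in merger X); first by case/mergerP: ur => w; exact: KMerger.
by apply: KKept; rewrite inE !in_fsetU us ul ur.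
Qed.

Lemma kept_split u : u \in kept X -> u \in split X -> False.
Proof. by rewrite inE !in_fsetU => /andP[+ _] us; rewrite us. Qed.

Lemma kept_mergel u v : u \in kept X -> (u, v) \in merging X -> False.
Proof.
rewrite inE !in_fsetU => /andP[+ _] uv; have -> : u \in mergel X.
  by apply/mergelP; exists v.
by rewrite orbT.
Qed.

Lemma kept_merger u v : v \in kept X -> (u, v) \in merging X -> False.
Proof.
rewrite inE !in_fsetU => /andP[+ _] uv; have -> : v \in merger X.
  by apply/mergerP; exists u.
by rewrite orbT.
Qed.

Lemma split_mergel u v : u \in split X -> (u, v) \in merging X -> False.
Proof. by rewrite inE => /andP[_ h] /mergingP[_ _ _]; rewrite h. Qed.

Lemma split_merger u v : v \in split X -> (u, v) \in merging X -> False.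
Proof. by rewrite inE => /andP[h _] /mergingP[_ _ _ _]; rewrite h. Qed.

Lemma mergel_merger u v w :
  (u, v) \in merging X -> (w, u) \in merging X -> False.
Proof. by move=> /mergingP[_ h _ _ _] /mergingP[_ _ _ _]; rewrite h. Qed.

Lemma neq_nl u x : u \in V X -> x \in V X -> nl u <> x.
Proof.
by move=> uV xV; rewrite -(dot_nil x) => /(C1_names hX uV xV)[].
Qed.

Lemma neq_nr u x : u \in V X -> x \in V X -> nr u <> x.
Proof.
by move=> uV xV; rewrite -(dot_nil x) => /(C1_names hX uV xV)[].
Qed.

Lemma neq_nl_nr u x : u \in V X -> x \in V X -> nl u <> nr x.
Proof. by move=> uV xV /(C1_names hX uV xV)[]. Qed.

Lemma nl_inj u x : u \in V X -> x \in V X -> nl u = nl x -> u = x.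
Proof. by move=> uV xV /(C1_names hX uV xV)[]. Qed.

Lemma nr_inj u x : u \in V X -> x \in V X -> nr u = nr x -> u = x.
Proof. by move=> uV xV /(C1_names hX uV xV)[]. Qed.

Lemma neq_vee u v x : u \in V X -> x \in V X -> vee u v <> x.
Proof. by move=> uV xV /(congr1 (@nl K)); rewrite nl_vee => /esym/(neq_nl xV uV). Qed.

Lemma neq_vee_nl u v x : u \in V X -> x \in V X -> vee u v <> nl x.
Proof.
move=> uV xV /(congr1 (@nl K)); rewrite nl_vee /nl dot_cat -(dot_nil u).
by move=> /(C1_names hX uV xV)[].
Qed.

Lemma neq_vee_nr u v x : u \in V X -> x \in V X -> vee u v <> nr x.
Proof.
move=> uV xV /(congr1 (@nl K)); rewrite nl_vee /nl /nr dot_cat -(dot_nil u).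
by move=> /(C1_names hX uV xV)[].
Qed.

Variant new_spec w : Prop :=
| NKept of w \in kept X
| NL u of u \in split X & w = nl u
| NR u of u \in split X & w = nr u
| NM u v of (u, v) \in merging X & w = vee u v.

Lemma Istep_VP w : w \in V Y <-> new_spec w.
Proof.
split.
  rewrite !in_fsetU => /orP[/orP[/orP[|]|]|]; first exact: NKept.
  - by move=> /imfsetP[u /= us ->]; exact: NL us _.
  - by move=> /imfsetP[u /= us ->]; exact: NR us _.
  - by move=> /imfsetP[[u v] /= us ->]; exact: NM us _.
case=> [wk|u us ->|u us ->|u v uv ->]; rewrite !in_fsetU.
- by rewrite wk.
- by rewrite (in_imfset _ (@nl K) us) /= !orbT.
- by rewrite (in_imfset _ (@nr K) us) /= !orbT.
- by rewrite (in_imfset _ (fun e => vee e.1 e.2) uv) /= !orbT.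
Qed.

Lemma Istep_a1P w : w \in a1 Y <-> [\/ w \in kept X /\ w \in a1 X,
  exists2 u, u \in split X & w = nl u |
  exists u v, (u, v) \in merging X /\ w = vee u v].
Proof.
split.
  rewrite !in_fsetU in_fsetI => /orP[/orP[/andP[wa wk]|]|]; first by constructor 1.
  - by move=> /imfsetP[u /= us ->]; constructor 2; exists u.
  - by move=> /imfsetP[[u v] /= uv ->]; constructor 3; exists u, v.
rewrite !in_fsetU in_fsetI; case=> [[-> ->] //|[u us ->]|[u [v [uv ->]]]].
- by rewrite (in_imfset _ (@nl K) us) /= !orbT.
- by rewrite (in_imfset _ (fun e => vee e.1 e.2) uv) /= !orbT.
Qed.

Lemma Istep_b1P w : w \in b1 Y <-> [\/ w \in kept X /\ w \in b1 X,
  exists2 u, u \in split X & w = nr u |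
  exists u v, (u, v) \in merging X /\ w = vee u v].
Proof.
split.
  rewrite !in_fsetU in_fsetI => /orP[/orP[/andP[wa wk]|]|]; first by constructor 1.
  - by move=> /imfsetP[u /= us ->]; constructor 2; exists u.
  - by move=> /imfsetP[[u v] /= uv ->]; constructor 3; exists u, v.
rewrite !in_fsetU in_fsetI; case=> [[-> ->] //|[u us ->]|[u [v [uv ->]]]].
- by rewrite (in_imfset _ (@nr K) us) /= !orbT.
- by rewrite (in_imfset _ (fun e => vee e.1 e.2) uv) /= !orbT.
Qed.

Lemma a1_kept u : u \in kept X -> (u \in a1 Y) = (u \in a1 X).
Proof.
move=> uk; have uV := keptV uk; apply/idP/idP => [/Istep_a1P|h].
  case=> [[]//|[v /splitV vs]|[v [w [/mergingV[vV wV]]]]] /esym.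
  - by move=> /neq_nl; case.
  - by move=> /neq_vee; case.
by apply/Istep_a1P; constructor 1.
Qed.

Lemma b1_kept u : u \in kept X -> (u \in b1 Y) = (u \in b1 X).
Proof.
move=> uk; have uV := keptV uk; apply/idP/idP => [/Istep_b1P|h].
  case=> [[]//|[v /splitV vs]|[v [w [/mergingV[vV wV]]]]] /esym.
  - by move=> /neq_nr; case.
  - by move=> /neq_vee; case.
by apply/Istep_b1P; constructor 1.
Qed.

Lemma a1_nl u : u \in split X -> nl u \in a1 Y.
Proof. by move=> us; apply/Istep_a1P; constructor 2; exists u. Qed.

Lemma b1_nr u : u \in split X -> nr u \in b1 Y.
Proof. by move=> us; apply/Istep_b1P; constructor 2; exists u. Qed.

Lemma a1_vee u v : (u, v) \in merging X -> vee u v \in a1 Y.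
Proof. by move=> us; apply/Istep_a1P; constructor 3; exists u, v. Qed.

Lemma b1_vee u v : (u, v) \in merging X -> vee u v \in b1 Y.
Proof. by move=> us; apply/Istep_b1P; constructor 3; exists u, v. Qed.

Lemma a1_nr u : u \in split X -> nr u \notin a1 Y.
Proof.
move=> /splitV uV; apply/negP => /Istep_a1P.
case=> [[/keptV wV _]|[v /splitV vs]|[v [w [/mergingV[vV wV]]]]].
- exact: neq_nr uV wV erefl.
- by move/esym; exact: neq_nl_nr.
- by move/esym; exact: neq_vee_nr.
Qed.

Lemma b1_nl u : u \in split X -> nl u \notin b1 Y.
Proof.
move=> /splitV uV; apply/negP => /Istep_b1P.
case=> [[/keptV wV _]|[v /splitV vs]|[v [w [/mergingV[vV wV]]]]].
- exact: neq_nl uV wV erefl.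
- exact: neq_nl_nr.
- by move/esym; exact: neq_vee_nl.
Qed.

Lemma nonmergel u v : (u, v) \in E X -> (u, v) \notin merging X ->
  u \notin mergel X.
Proof.
move=> uv /negP h; apply/mergelP => -[w uw]; apply: h.
by rewrite (edgeb hX uv (merging_E uw)).
Qed.

Lemma nonmerger u v : (u, v) \in E X -> (u, v) \notin merging X ->
  v \notin merger X.
Proof.
move=> uv /negP h; apply/mergerP => -[w wv]; apply: h.
by rewrite (edgea hX uv (merging_E wv)).
Qed.

Lemma porta_kept u : u \in kept X -> porta X u = u.
Proof.
move=> uk; rewrite /porta; case: ifP => [/(kept_split uk)//|_].
by case: ifP => [/mergelP[v /(kept_mergel uk)]|].
Qed.

Lemma portb_kept u : u \in kept X -> portb X u = u.
Proof.
move=> uk; rewrite /portb; case: ifP => [/(kept_split uk)//|_].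
by case: ifP => [/mergerP[v /(kept_merger uk)]|].
Qed.

Lemma porta_split u : u \in split X -> porta X u = nl u.
Proof. by rewrite /porta => ->. Qed.

Lemma portb_split u : u \in split X -> portb X u = nr u.
Proof. by rewrite /portb => ->. Qed.

Lemma porta_merging u v : (u, v) \in merging X -> porta X u = vee u v.
Proof.
move=> uv; rewrite /porta; case: ifP => [/split_mergel/(_ uv)//|_].
have -> : u \in mergel X by apply/mergelP; exists v.
by rewrite (rightP hX (merging_E uv)).
Qed.

Lemma portb_merging u v : (u, v) \in merging X -> portb X v = vee u v.
Proof.
move=> uv; rewrite /portb; case: ifP => [/split_merger/(_ uv)//|_].
have -> : v \in merger X by apply/mergerP; exists u.
by rewrite (leftP hX (merging_E uv)).
Qed.

Lemma Istep_EP x y : (x, y) \in E Y <->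
  (exists u v, [/\ (u, v) \in E X, (u, v) \notin merging X,
                  x = portb X u & y = porta X v]) \/
  (exists2 u, u \in split X & x = nl u /\ y = nr u).
Proof.
split.
  rewrite in_fsetU => /orP[/imfsetP[[u v]]|/imfsetP[u]] /=.
    by rewrite in_fsetD => /andP[uvM uvE] [-> ->]; left; exists u, v.
  by move=> us [-> ->]; right; exists u.
rewrite in_fsetU => -[[u [v [uvE uvM -> ->]]]|[u us [-> ->]]].
  have uvD : (u, v) \in E X `\` merging X by rewrite in_fsetD uvM.
  by rewrite (in_imfset _ (fun e => (portb X e.1, porta X e.2)) uvD).
by rewrite (in_imfset _ (fun u => (nl u, nr u)) us) orbT.
Qed.

Lemma Istep_E_old u v : (u, v) \in E X -> (u, v) \notin merging X ->
  (portb X u, porta X v) \in E Y.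
Proof. by move=> uv uvM; apply/Istep_EP; left; exists u, v. Qed.

Lemma Istep_E_split u : u \in split X -> (nl u, nr u) \in E Y.
Proof. by move=> us; apply/Istep_EP; right; exists u. Qed.

Lemma porta_new u : u \in V X -> u \notin merger X -> porta X u \in V Y.
Proof.
move=> uV ur; apply/Istep_VP; case: (kindP uV) => [uk|us|v uv|w wu].
- by rewrite porta_kept //; exact: NKept.
- by rewrite porta_split //; exact: NL us _.
- by rewrite (porta_merging uv) //; exact: NM uv _.
- by case/negP: ur; apply/mergerP; exists w.
Qed.

Lemma portb_new u : u \in V X -> u \notin mergel X -> portb X u \in V Y.
Proof.
move=> uV ur; apply/Istep_VP; case: (kindP uV) => [uk|us|v uv|w wu].
- by rewrite portb_kept //; exact: NKept.
- by rewrite portb_split //; exact: NR us _.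
- by case/negP: ur; apply/mergelP; exists v.
- by rewrite (portb_merging wu) //; exact: NM wu _.
Qed.

Lemma portb_word u : u \in V X -> u \notin mergel X ->
  exists2 s, dot (portb X u) [:: lt_r] = dot u s & s <> [:: lt_l; lt_r].
Proof.
move=> uV ul; case: (kindP uV) => [uk|us|v uv|w wu].
- by rewrite portb_kept //; exists [:: lt_r].
- by rewrite portb_split //; exists [:: lt_r; lt_r] => //; rewrite dot_nr.
- by case/negP: ul; apply/mergelP; exists v.
- by rewrite (portb_merging wu); exists [::] => //; rewrite dot_vee_r.
Qed.

Lemma porta_word u : u \in V X -> u \notin merger X ->
  exists2 s, dot (porta X u) [:: lt_l] = dot u s & s <> [:: lt_r; lt_l].
Proof.
move=> uV ul; case: (kindP uV) => [uk|us|v uv|w wu].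
- by rewrite porta_kept //; exists [:: lt_l].
- by rewrite porta_split //; exists [:: lt_l; lt_l] => //; rewrite dot_nl.
- by rewrite (porta_merging uv); exists [::] => //; rewrite dot_vee_l.
- by case/negP: ul; apply/mergerP; exists w.
Qed.

Lemma portb_inj u v : u \in V X -> v \in V X -> u \notin mergel X ->
  v \notin mergel X -> portb X u = portb X v -> u = v.
Proof.
move=> uV vV ul vl e; have [s hs _] := portb_word uV ul.
have [s' hs' _] := portb_word vV vl; move: hs; rewrite e hs'.
by move=> /(C1_names hX vV uV)[].
Qed.

Lemma porta_inj u v : u \in V X -> v \in V X -> u \notin merger X ->
  v \notin merger X -> porta X u = porta X v -> u = v.
Proof.
move=> uV vV ul vl e; have [s hs _] := porta_word uV ul.
have [s' hs' _] := porta_word vV vl; move: hs; rewrite e hs'.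
by move=> /(C1_names hX vV uV)[].
Qed.

Lemma portb_nl u v : u \in V X -> v \in V X -> u \notin mergel X ->
  portb X u <> nl v.
Proof.
move=> uV vV ul e; have [s + hs] := portb_word uV ul.
by rewrite e dot_nl => /(C1_names hX vV uV)[_ /esym/hs].
Qed.

Lemma porta_nr u v : u \in V X -> v \in V X -> u \notin merger X ->
  porta X u <> nr v.
Proof.
move=> uV vV ul e; have [s + hs] := porta_word uV ul.
by rewrite e dot_nr => /(C1_names hX vV uV)[_ /esym/hs].
Qed.

Lemma Istep_Eb x y y' : (x, y) \in E Y -> (x, y') \in E Y -> y = y'.
Proof.
move=> /Istep_EP[[u [v [uv uvM -> ->]]]|[u us [-> ->]]];
  move=> /Istep_EP[[u' [v' [uv' uvM' + ->]]]|[u' us' [+ ->]]].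
- move=> e; have [uV _] := C1_edge hX uv; have [uV' _] := C1_edge hX uv'.
  have ? := portb_inj uV uV' (nonmergel uv uvM) (nonmergel uv' uvM') e.
  by subst u'; rewrite (edgeb hX uv uv').
- have [uV _] := C1_edge hX uv.
  by move=> /(portb_nl uV (splitV us') (nonmergel uv uvM)).
- have [uV' _] := C1_edge hX uv'.
  by move=> /esym/(portb_nl uV' (splitV us) (nonmergel uv' uvM')).
- by move=> /(nl_inj (splitV us) (splitV us')) ->.
Qed.

Lemma Istep_Ea x x' y : (x, y) \in E Y -> (x', y) \in E Y -> x = x'.
Proof.
move=> /Istep_EP[[u [v [uv uvM -> ->]]]|[u us [-> ->]]];
  move=> /Istep_EP[[u' [v' [uv' uvM' -> +]]]|[u' us' [-> +]]].
- move=> e; have [_ vV] := C1_edge hX uv; have [_ vV'] := C1_edge hX uv'.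
  have ? := porta_inj vV vV' (nonmerger uv uvM) (nonmerger uv' uvM') e.
  by subst v'; rewrite (edgea hX uv uv').
- have [_ vV] := C1_edge hX uv.
  by move=> /(porta_nr vV (splitV us') (nonmerger uv uvM)).
- have [_ vV'] := C1_edge hX uv'.
  by move=> /esym/(porta_nr vV' (splitV us) (nonmerger uv' uvM')).
- by move=> /(nr_inj (splitV us) (splitV us')) ->.
Qed.

Variant foot : name K -> seq letter -> name K -> seq letter -> Prop :=
| FKept u s of u \in kept X : foot u s u s
| FL u s of u \in split X : foot (nl u) s u (lt_l :: s)
| FR u s of u \in split X : foot (nr u) s u (lt_r :: s)
| FMl u v s of (u, v) \in merging X : foot (vee u v) (lt_l :: s) u s
| FMr u v s of (u, v) \in merging X : foot (vee u v) (lt_r :: s) v s.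

Lemma foot_dot w s u s' : foot w s u s' -> dot w s = dot u s' /\ u \in V X.
Proof.
case=> [u' t uk|u' t us|u' t us|u' v t uv|u' v t uv].
- by split=> //; exact: keptV.
- by rewrite dot_nl; split=> //; exact: splitV.
- by rewrite dot_nr; split=> //; exact: splitV.
- by rewrite dot_vee_l; split=> //; have [] := mergingV uv.
- by rewrite dot_vee_r; split=> //; have [] := mergingV uv.
Qed.

Lemma foot_ex w d s : w \in V Y -> exists u s', foot w (d :: s) u s'.
Proof.
move=> /Istep_VP[wk|u us ->|u us ->|u v uv ->].
- by exists w, (d :: s); constructor.
- by exists u, (lt_l :: d :: s); constructor.
- by exists u, (lt_r :: d :: s); constructor.
- by case: d; [exists u|exists v]; exists s; constructor.
Qed.

Lemma foot_inj w1 s1 w2 s2 u s :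
  foot w1 s1 u s -> foot w2 s2 u s -> w1 = w2 /\ s1 = s2.
Proof.
case=> [x t xk|x t xs|x t xs|x y t xy|x y t xy] h;
  inversion h as [x' t' x'k|x' t' x's|x' t' x's|x' y' t' x'y'|x' y' t' x'y'];
  subst => //; try by
  [ case: (kept_split xk) | case: (kept_split x'k)
  | case: (kept_mergel xk x'y') | case: (kept_mergel x'k xy)
  | case: (kept_merger xk x'y') | case: (kept_merger x'k xy)
  | case: (split_mergel xs x'y') | case: (split_mergel x's xy)
  | case: (split_merger xs x'y') | case: (split_merger x's xy)
  | case: (mergel_merger xy x'y') | case: (mergel_merger x'y' xy)].
- by rewrite (edgeb hX (merging_E xy) (merging_E x'y')).
- by rewrite (edgea hX (merging_E xy) (merging_E x'y')).
Qed.

Lemma Istep_C1 : C1 Y.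
Proof.
have new_of u : u \in V X -> exists w, w \in V Y.
  move=> uV; case: (kindP uV) => [uk|us|v uv|v vu].
  - by exists u; apply/Istep_VP; exact: NKept.
  - by exists (nl u); apply/Istep_VP; exact: NL us _.
  - by exists (vee u v); apply/Istep_VP; exact: NM uv _.
  - by exists (vee v u); apply/Istep_VP; exact: NM vu _.
have merged_right u v : (u, v) \in merging X -> (v, rneigh X v) \in E X /\
    (v, rneigh X v) \notin merging X.
  move=> uv; have [_ vV] := mergingV uv; split; first exact: right_edge.
  by apply/negP => h; exact: mergel_merger h uv.
have merged_left u v : (u, v) \in merging X -> (lneigh X u, u) \in E X /\
    (lneigh X u, u) \notin merging X.
  move=> uv; have [uV _] := mergingV uv; split; first exact: left_edge.
  by apply/negP => h; exact: mergel_merger uv h.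
split.
- have /fset0Pn[u uV] := C1_nonempty hX; have [w wV] := new_of u uV.
  by apply/fset0Pn; exists w.
- move=> v v' t t' vV vV' h.
  have : dot v (rcons t lt_l) = dot v' (rcons t' lt_l).
    by rewrite -!cats1 -!dot_cat h.
  case ht: (rcons t lt_l) => [|d s]; first by case: (t) ht.
  case ht': (rcons t' lt_l) => [|d' s']; first by case: (t') ht'.
  have [u [r f]] := foot_ex d s vV; have [u' [r' f']] := foot_ex d' s' vV'.
  have [-> uV] := foot_dot f; have [-> uV'] := foot_dot f'.
  move=> /(C1_names hX uV uV')[? ?]; subst u' r'.
  have [-> e] := foot_inj f f'; split=> //.
  by move: ht ht'; rewrite e => <- /rcons_inj[].
- move=> x y /Istep_EP[[u [v [uv uvM -> ->]]]|[u us [-> ->]]].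
    have [uV vV] := C1_edge hX uv; split.
      by apply: portb_new => //; exact: nonmergel uv uvM.
    by apply: porta_new => //; exact: nonmerger uv uvM.
  by split; apply/Istep_VP; [exact: NL us _|exact: NR us _].
- move=> x xV; suff [y xy] : exists y, (x, y) \in E Y.
    by exists y; split=> // z; exact: Istep_Eb.
  case/Istep_VP: xV => [xk|u us ->|u us ->|u v uv ->].
  - have xE := right_edge hX (keptV xk).
    exists (porta X (rneigh X x)); rewrite -{1}(portb_kept xk).
    by apply: Istep_E_old => //; apply/negP; exact: kept_mergel.
  - by exists (nr u); exact: Istep_E_split.
  - have uE := right_edge hX (splitV us).
    exists (porta X (rneigh X u)); rewrite -(portb_split us).
    by apply: Istep_E_old => //; apply/negP; exact: split_mergel.
  - have [vE vM] := merged_right _ _ uv.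
    exists (porta X (rneigh X v)); rewrite -(portb_merging uv).
    exact: Istep_E_old.
- move=> x xV; suff [y xy] : exists y, (y, x) \in E Y.
    by exists y; split=> // z; exact: Istep_Ea.
  case/Istep_VP: xV => [xk|u us ->|u us ->|u v uv ->].
  - have xE := left_edge hX (keptV xk).
    exists (portb X (lneigh X x)); rewrite -{2}(porta_kept xk).
    by apply: Istep_E_old => //; apply/negP; exact: kept_merger.
  - have uE := left_edge hX (splitV us).
    exists (portb X (lneigh X u)); rewrite -(porta_split us).
    by apply: Istep_E_old => //; apply/negP; exact: split_merger.
  - by exists (nl u); exact: Istep_E_split.
  - have [vE vM] := merged_left _ _ uv.
    exists (portb X (lneigh X u)); rewrite -(porta_merging uv).
    exact: Istep_E_old.
- pose rep u := if u \in merger X then portb X u else porta X u.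
  have rep_portb u : u \in V X -> u \notin mergel X ->
      conn Y (rep u) (portb X u).
    move=> uV ul; rewrite /rep; case: ifP => [_|/negbT ur].
      exact: conn_refl.
    case: (kindP uV) => [uk|us|v uv|v vu].
    - by rewrite porta_kept // portb_kept //; exact: conn_refl.
    - rewrite porta_split // portb_split //.
      by apply: conn_edge; exact: Istep_E_split.
    - by case/negP: ul; apply/mergelP; exists v.
    - by case/negP: ur; apply/mergerP; exists v.
  have rep_edge u v : (u, v) \in E X -> conn Y (rep u) (rep v).
    move=> uv; have [uV vV] := C1_edge hX uv.
    case: (boolP ((u, v) \in merging X)) => uvM.
      have vr : v \in merger X by apply/mergerP; exists u.
      have ur : u \notin merger X.
        by apply/mergerP => -[w]; exact: mergel_merger uvM.
      rewrite /rep vr (negbTE ur) (porta_merging uvM) (portb_merging uvM).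
      exact: conn_refl.
    apply: (conn_trans (rep_portb u uV (nonmergel uv uvM))).
    rewrite /rep (negbTE (nonmerger uv uvM)).
    by apply: conn_edge; exact: Istep_E_old.
  have rep_ex w : w \in V Y -> exists2 u, u \in V X & conn Y w (rep u).
    have not_r u : u \in split X -> u \notin merger X.
      by move=> us; apply/mergerP => -[z]; exact: split_merger.
    have nlrep u : u \in split X -> rep u = nl u.
      by move=> us; rewrite /rep (negbTE (not_r u us)) porta_split.
    case/Istep_VP=> [wk|u us ->|u us ->|u v uv ->].
    - exists w; first exact: keptV.
      rewrite /rep; have -> : (w \in merger X) = false.
        by apply/mergerP => -[z]; exact: kept_merger.
      by rewrite porta_kept //; exact: conn_refl.
    - by exists u; [exact: splitV|rewrite nlrep //; exact: conn_refl].
    - exists u; first exact: splitV.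
      by rewrite nlrep //; apply/conn_sym/conn_edge/Istep_E_split.
    - have [_ vV] := mergingV uv; exists v => //.
      rewrite /rep; have -> : v \in merger X by apply/mergerP; exists u.
      by rewrite (portb_merging uv); exact: conn_refl.
  move=> x y /rep_ex[u uV xu] /rep_ex[v vV yv].
  apply: (conn_trans xu); apply: conn_trans (conn_sym yv).
  by apply: (conn_map rep_edge); exact: C1_connected.
- apply/fsubsetP => w /Istep_a1P[[wk _]|[u us ->]|[u [v [uv ->]]]].
  + by apply/Istep_VP; exact: NKept.
  + by apply/Istep_VP; exact: NL us _.
  + by apply/Istep_VP; exact: NM uv _.
- apply/fsubsetP => w /Istep_b1P[[wk _]|[u us ->]|[u [v [uv ->]]]].
  + by apply/Istep_VP; exact: NKept.
  + by apply/Istep_VP; exact: NR us _.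
  + by apply/Istep_VP; exact: NM uv _.
Qed.

Lemma Istep_splitP w :
  w \in split Y <-> exists u v, (u, v) \in merging X /\ w = vee u v.
Proof.
rewrite in_fsetI; split; last first.
  by move=> [u [v [uv ->]]]; rewrite a1_vee // b1_vee.
move=> /andP[/Istep_a1P[[wk wa]|[u us ->]|//]].
  by rewrite b1_kept // => wb; case: (kept_split wk); rewrite in_fsetI wa.
by rewrite (negbTE (b1_nl us)).
Qed.

End StepITheory.

Section StepIK.
Context {K : Type} (X : graph K) (hX : C1 X).

Let Y := Istep X.
Let hY : C1 Y := Istep_C1 hX.

Lemma Istep_mergingP x y :
  (x, y) \in merging Y <-> exists2 u, u \in split X & x = nl u /\ y = nr u.
Proof.
split; last first.
  move=> [u us [-> ->]]; apply/mergingP; rewrite a1_nl // b1_nr //.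
  by rewrite b1_nl // a1_nr //; split=> //; exact: Istep_E_split.
move=> /mergingP[/(Istep_EP X)[|//] [u [v [uv uvM -> ->]]] ua vb ub va].
exfalso; have [uV vV] := C1_edge hX uv.
have uk : u \in kept X.
  case: (kindP uV) => [//|us|w uw|w wu].
  - by move: ua; rewrite portb_split // (negbTE (a1_nr hX us)).
  - by case/negP: (nonmergel hX uv uvM); apply/mergelP; exists w.
  - by move: ub; rewrite (portb_merging hX wu) b1_vee.
have vk : v \in kept X.
  case: (kindP vV) => [//|us|w uw|w wu].
  - by move: vb; rewrite porta_split // (negbTE (b1_nl hX us)).
  - by move: va; rewrite (porta_merging hX uw) a1_vee.
  - by case/negP: (nonmerger hX uv uvM); apply/mergerP; exists w.
move: ua ub vb va; rewrite portb_kept // porta_kept // (a1_kept hX uk) (a1_kept hX vk).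
rewrite (b1_kept hX uk) (b1_kept hX vk).
by move=> *; case/negP: uvM; apply/mergingP.
Qed.

Lemma Istep_kept : kept Y = kept X.
Proof.
apply/fsetP => w; apply/idP/idP => [wk|wk].
  have wV := keptV wk; case/(Istep_VP X): wV => [//|u us e|u us e|u v uv e].
  - case: (kept_mergel wk (v := nr u)).
    by apply/Istep_mergingP; exists u.
  - case: (kept_merger wk (u := nl u)).
    by apply/Istep_mergingP; exists u.
  - by case: (kept_split wk); apply/(Istep_splitP hX); exists u, v.
have wV : w \in V Y by apply/Istep_VP; exact: NKept.
case: (kindP wV) => [//|/(Istep_splitP hX)|z /Istep_mergingP|z /Istep_mergingP].
- move=> [u [v [uv e]]]; have [uV vV] := mergingV hX uv.
  by case: (neq_vee hX uV (keptV wk) (esym e)).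
- by move=> [u us [e _]]; case: (neq_nl hX (splitV hX us) (keptV wk) (esym e)).
- by move=> [u us [_ e]]; case: (neq_nr hX (splitV hX us) (keptV wk) (esym e)).
Qed.

Lemma split_merging u : u \in split X -> (nl u, nr u) \in merging Y.
Proof. by move=> us; apply/Istep_mergingP; exists u. Qed.

Lemma merging_split u v : (u, v) \in merging X -> vee u v \in split Y.
Proof. by move=> uv; apply/(Istep_splitP hX); exists u, v. Qed.

Lemma porta_porta v : v \in V X -> v \notin merger X ->
  porta Y (porta X v) = v.
Proof.
move=> vV vr; case: (kindP vV) => [vk|vs|w vw|w wv].
- have vk' : v \in kept Y by rewrite Istep_kept.
  by rewrite (porta_kept vk) (porta_kept vk').
- by rewrite (porta_split vs) (porta_merging hY (split_merging vs)) vee_nlnr.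
- by rewrite (porta_merging hX vw) (porta_split (merging_split vw)) nl_vee.
- by case/negP: vr; apply/mergerP; exists w.
Qed.

Lemma portb_portb v : v \in V X -> v \notin mergel X ->
  portb Y (portb X v) = v.
Proof.
move=> vV vr; case: (kindP vV) => [vk|vs|w vw|w wv].
- have vk' : v \in kept Y by rewrite Istep_kept.
  by rewrite (portb_kept vk) (portb_kept vk').
- by rewrite (portb_split vs) (portb_merging hY (split_merging vs)) vee_nlnr.
- by case/negP: vr; apply/mergelP; exists w.
- by rewrite (portb_merging hX wv) (portb_split (merging_split wv)) nr_vee.
Qed.

Lemma old_not_merging u v : (u, v) \in E X -> (u, v) \notin merging X ->
  (portb X u, porta X v) \notin merging Y.
Proof.
move=> uv uvM; have [uV vV] := C1_edge hX uv.
apply/negP => /Istep_mergingP[w ws [e _]].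
by case: (portb_nl hX uV (splitV hX ws) (nonmergel hX uv uvM) e).
Qed.

Lemma IstepK : Istep (Istep X) = X.
Proof.
rewrite -/Y; apply: graph_eq; apply/fsetP.
- move=> w; apply/idP/idP => [/(Istep_VP Y)|wV].
    case=> [|u|u|u v]; first by rewrite Istep_kept; exact: keptV.
    - move=> /(Istep_splitP hX)[x [y [xy ->]]] ->; rewrite nl_vee.
      by have [] := mergingV hX xy.
    - move=> /(Istep_splitP hX)[x [y [xy ->]]] ->; rewrite nr_vee.
      by have [] := mergingV hX xy.
    - move=> /Istep_mergingP[x xs [-> ->]] ->; rewrite vee_nlnr.
      exact: splitV.
  apply/Istep_VP; case: (kindP wV) => [wk|ws|v wv|v vw].
  - by apply: NKept; rewrite Istep_kept.
  - by apply: (NM (split_merging ws)); rewrite vee_nlnr.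
  - by apply: (NL (merging_split wv)); rewrite nl_vee.
  - by apply: (NR (merging_split vw)); rewrite nr_vee.
- move=> [x y]; apply/idP/idP.
    move=> /(Istep_EP Y)[[u [v [uv uvM -> ->]]]|[u us [-> ->]]].
      case/(Istep_EP X): uv uvM => [[u' [v' [uv' uvM' -> ->]]] _|[z zs [-> ->]]].
        have [uV vV] := C1_edge hX uv'; have ul := nonmergel hX uv' uvM'.
        have vr := nonmerger hX uv' uvM'.
        by rewrite portb_portb // porta_porta.
      by rewrite split_merging.
    case/(Istep_splitP hX): us => [z [t [zt ->]]]; rewrite nl_vee nr_vee.
    exact: merging_E.
  move=> xy; have [xV yV] := C1_edge hX xy; apply/Istep_EP.
  case: (boolP ((x, y) \in merging X)) => xyM.
    right; exists (vee x y); last by rewrite nl_vee nr_vee.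
    exact: merging_split.
  left; exists (portb X x), (porta X y); split.
  - exact: Istep_E_old.
  - exact: old_not_merging.
  - by rewrite (portb_portb xV (nonmergel hX xy xyM)).
  - by rewrite (porta_porta yV (nonmerger hX xy xyM)).
- move=> w; apply/idP/idP.
    move=> /(Istep_a1P Y)[[wk]|[u us ->]|[u [v [uv ->]]]].
    - by move: wk; rewrite Istep_kept => wk; rewrite (a1_kept hX wk).
    - case/(Istep_splitP hX): us => [x [y [xy ->]]]; rewrite nl_vee.
      by case/mergingP: xy.
    - case/Istep_mergingP: uv => z + [-> ->]; rewrite vee_nlnr.
      by rewrite in_fsetI => /andP[].
  move=> wa; apply/Istep_a1P; have wV := fsubsetP (C1_a1 hX) _ wa.
  case: (kindP wV) => [wk|ws|v wv|v vw].
  - by constructor 1; rewrite Istep_kept (a1_kept hX wk).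
  - constructor 3; exists (nl w), (nr w).
    by rewrite vee_nlnr; split=> //; exact: split_merging.
  - constructor 2; exists (vee w v); last by rewrite nl_vee.
    exact: merging_split.
  - by case/mergingP: vw => _ _ _ _; rewrite wa.
- move=> w; apply/idP/idP.
    move=> /(Istep_b1P Y)[[wk]|[u us ->]|[u [v [uv ->]]]].
    - by move: wk; rewrite Istep_kept => wk; rewrite (b1_kept hX wk).
    - case/(Istep_splitP hX): us => [x [y [xy ->]]]; rewrite nr_vee.
      by case/mergingP: xy.
    - case/Istep_mergingP: uv => z + [-> ->]; rewrite vee_nlnr.
      by rewrite in_fsetI => /andP[].
  move=> wb; apply/Istep_b1P; have wV := fsubsetP (C1_b1 hX) _ wb.
  case: (kindP wV) => [wk|ws|v wv|v vw].
  - by constructor 1; rewrite Istep_kept (b1_kept hX wk).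
  - constructor 3; exists (nl w), (nr w).
    by rewrite vee_nlnr; split=> //; exact: split_merging.
  - by case/mergingP: wv => _ _ _; rewrite wb.
  - constructor 2; exists (vee v w); last by rewrite nr_vee.
    exact: merging_split.
Qed.

End StepIK.

Theorem step_C1 (K : Type) (X : graph K) : C1 X -> C1 (step X).
Proof. by move=> hX; apply/sqrt_tau_C1/Istep_C1. Qed.

Theorem step_inv_C1 (K : Type) (X : graph K) : C1 X -> C1 (step_inv X).
Proof. by move=> hX; apply/Istep_C1/sqrt_tau_inv_C1. Qed.

Theorem stepK (K : Type) (X : graph K) : C1 X -> step_inv (step X) = X.
Proof.
move=> hX; rewrite /step_inv /step sqrt_tauK ?IstepK //; exact: Istep_C1.
Qed.

Theorem step_invK (K : Type) (X : graph K) : C1 X -> step (step_inv X) = X.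
Proof.
move=> hX; rewrite /step_inv /step IstepK ?sqrt_tau_invK //.
exact: sqrt_tau_inv_C1.
Qed.

(* Main.v *)
Require Import Defs.
From mathcomp Require Import all_boot all_order all_algebra.
From mathcomp Require Import finmap reals.
From mathcomp Require Import zify.

(* One inverse step moves the a-particles half an edge to the right and the
   b-particles half an edge to the left, then applies I. Call an edge {u:b, v:a}
   with a_1(u) = b_1(v) = 1 a bond. Its two particles meet on one vertex, which
   splits and restores the bond, so a bond persists and inserts one vertex at
   each step. As long as there is no bond nothing splits, and a-particles and
   b-particles get closer and merge until the cycle is short enough for a bond
   to appear. Once the cycle is cut at a bond, every merge removes one of the
   pairs (a-particle, b-particle to its right) and nothing creates such a pair,
   so only boundedly many vertices are ever lost: the growth is at least n - O(1).
   It is at most linear since a split needs an a-particle, and the number of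
   a-particles does not increase. *)

Set Implicit Arguments.
Unset Strict Implicit.
Unset Printing Implicit Defensive.

(** * Inversion counts of a sequence carrying two kinds of marks *)

Section Sequences.
Context {T : eqType}.

Lemma uniq_flatten_map (T' : eqType) (f : T -> seq T') (s : seq T) :
  uniq s -> (forall x, x \in s -> uniq (f x)) ->
  (forall x y w, x \in s -> y \in s -> w \in f x -> w \in f y -> x = y) ->
  uniq (flatten (map f s)).
Proof.
elim: s => //= x s IHs /andP[xs us] uf df; rewrite cat_uniq uf ?mem_head //=.
rewrite IHs // => [|y ys|y z w ys zs]; last 2 first.
- by apply: uf; rewrite inE ys orbT.
- by apply: df; rewrite inE ?ys ?zs orbT.
rewrite andbT; apply/hasPn => w /flatten_mapP[y ys wy]; apply/negP => wx.
move: xs; rewrite (df x y w) ?mem_head ?ys //.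
by rewrite inE ys orbT.
Qed.

Variables a b : pred T.

(** Counts the pairs of positions i < j with [a] at i and [b] at j; [inv_le] also counts i = j. The
    weak form describes the state after a half-hop, when formerly adjacent particles share a
    vertex. *)
Fixpoint inv_lt (s : seq T) : nat :=
  if s is x :: s' then a x * count b s' + inv_lt s' else 0.
Fixpoint inv_le (s : seq T) : nat :=
  if s is x :: s' then a x * count b (x :: s') + inv_le s' else 0.

Lemma inv_lt_cons s x : ~~ a x -> inv_lt (x :: s) = inv_lt s.
Proof. by move=> /= /negbTE->. Qed.

Lemma inv_lt_rcons s x : ~~ b x -> inv_lt (rcons s x) = inv_lt s.
Proof.
move=> bx; elim: s => //= [|y s ->]; first by rewrite muln0.
by rewrite -cats1 count_cat /= (negbTE bx) !addn0.
Qed.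

End Sequences.

Lemma card_le_image (T T' : choiceType) (f : T -> T') (A : {fset T'})
    (B : {fset T}) :
  (forall x, x \in A -> exists2 y, y \in B & x = f y) -> #|` A| <= #|` B|.
Proof.
move=> AB; rewrite -(size_map f (enum_fset B)).
apply: uniq_leq_size => [|x /AB[y yB ->]]; first exact: fset_uniq.
exact: map_f.
Qed.

(** * The cycle traversed to the right, and the inverse half-hop *)

Definition edge (K : Type) (X : graph K) : rel (name K) :=
  fun u v => (u, v) \in E X.

(** Indexes the vertices of [sqrt_tau_inv X] by those of [X], each edge being attributed to its left
    end. *)
Definition emid (K : Type) (X : graph K) (u : name K) : name K :=
  mid (u, rneigh X u).

Section Cycle.
Local Open Scope fset_scope.
Context {K : Type} (X : graph K) (hX : C1 X).

Lemma rneighV u : u \in V X -> rneigh X u \in V X.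
Proof. by move=> /(right_edge hX)/(C1_edge hX)[]. Qed.

Lemma rneigh_inj : {in V X &, injective (rneigh X)}.
Proof.
move=> u v uV vV e; have := right_edge hX vV; rewrite -e.
exact: edgea hX (right_edge hX uV).
Qed.

(** Restricted to the finite type of vertices, where the theory of orbits applies. *)
Definition sub_rneigh (u : V X) : V X := [` rneighV (valP u)].

Lemma sub_rneigh_inj : injective sub_rneigh.
Proof.
move=> u v /(congr1 val)/= /rneigh_inj e; apply: val_inj.
by apply: e; exact: valP.
Qed.

Lemma iter_sub_rneigh n u :
  val (iter n sub_rneigh u) = iter n (rneigh X) (val u).
Proof. by elim: n => //= n ->. Qed.

Lemma iter_rneighV n u : u \in V X -> iter n (rneigh X) u \in V X.
Proof. by move=> uV; elim: n => //= n; exact: rneighV. Qed.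

(** Reachability under an injective self-map of a finite set is symmetric, so the backward edges of
    an undirected path can be replaced by forward iterations. *)
Lemma reach_rneigh u v : u \in V X -> v \in V X ->
  exists n, iter n (rneigh X) u = v.
Proof.
move=> uV vV; suff c : fconnect sub_rneigh [` uV] [` vV].
  exists (findex sub_rneigh [` uV] [` vV]).
  by rewrite -[u]/(val [` uV]) -iter_sub_rneigh iter_findex.
have [p] := C1_connected hX uV vV.
elim: p u uV => [|w p IHp] u uV /=.
  by move=> _ e; rewrite (_ : [` uV] = [` vV]) //; exact: val_inj.
move=> /andP[uw pp] pv; have wV : w \in V X.
  by case/orP: uw => /(C1_edge hX)[].
apply: connect_trans (IHp w wV pp pv); case/orP: uw => e.
  rewrite (_ : [` wV] = sub_rneigh [` uV]) ?fconnect1 //.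
  by apply: val_inj => /=; rewrite (rightP hX e).
rewrite fconnect_sym; last exact: sub_rneigh_inj.
rewrite (_ : [` uV] = sub_rneigh [` wV]) ?fconnect1 //.
by apply: val_inj => /=; rewrite (rightP hX e).
Qed.

Lemma vertex_cycle v : v \in V X ->
  exists s, uniq (v :: s) /\ cycle (edge X) (v :: s).
Proof.
move=> vV; pose s := orbit sub_rneigh [` vV].
have us : uniq (map val s) by rewrite (map_inj_uniq val_inj) orbit_uniq.
have cs : cycle (edge X) (map val s).
  rewrite cycle_map; apply: sub_cycle (cycle_orbit sub_rneigh_inj _).
  by move=> x y /eqP <-; exact: right_edge hX (valP x).
have : map val s = v :: behead (map val s).
  by rewrite /s /orbit -orderSpred.
by move: us cs => + + e; rewrite e; exists (behead (map val s)).
Qed.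

Lemma cycleV s : cycle (edge X) s -> {subset s <= V X}.
Proof. by move=> cs x /(next_cycle cs)/(C1_edge hX)[]. Qed.

Lemma sti_edge u : u \in V X ->
  (emid X u, emid X (rneigh X u)) \in E (sqrt_tau_inv X).
Proof.
move=> uV; have vV := rneighV uV; apply/(sqrt_tau_EP (swap_bits X)).
by exists u, (rneigh X u), (rneigh X (rneigh X u)); split=> //; exact: right_edge.
Qed.

Lemma sti_VP x :
  reflect (exists2 u, u \in V X & x = emid X u) (x \in V (sqrt_tau_inv X)).
Proof.
apply: (iffP (sqrt_tau_VP (swap_bits X) x)) => [[[u v] uv ->]|[u uV ->]].
  exists u; first by have [] := C1_edge hX uv.
  by rewrite /emid (rightP hX uv).
by exists (u, rneigh X u) => //; exact: right_edge.
Qed.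

(** The inverse swaps the bits before hopping, so an a-particle follows the rule of b-particles and
    goes to the edge on its right. *)
Lemma sti_a1 u : u \in V X ->
  (emid X u \in a1 (sqrt_tau_inv X)) = (u \in a1 X).
Proof.
move=> uV; apply: (sqrt_tau_b1P (swap_bits_C1 hX) (e := (u, _))).
exact: right_edge.
Qed.

Lemma sti_b1 u : u \in V X ->
  (emid X u \in b1 (sqrt_tau_inv X)) = (rneigh X u \in b1 X).
Proof.
move=> uV; apply: (sqrt_tau_a1P (swap_bits_C1 hX) (e := (u, _))).
exact: right_edge.
Qed.

Lemma emid_inj : {in V X &, injective (emid X)}.
Proof.
move=> u v uV vV /(mid_injE hX (right_edge hX uV) (right_edge hX vV)).
by case.
Qed.

Lemma sti_rneigh u : u \in V X ->
  rneigh (sqrt_tau_inv X) (emid X u) = emid X (rneigh X u).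
Proof. by move=> /sti_edge; apply: rightP; exact: sqrt_tau_inv_C1. Qed.

Lemma sti_iter_rneigh n u : u \in V X ->
  iter n (rneigh (sqrt_tau_inv X)) (emid X u) = emid X (iter n (rneigh X) u).
Proof.
by move=> uV; elim: n => //= n ->; rewrite sti_rneigh // iter_rneighV.
Qed.

Lemma card_sti : #|` V (sqrt_tau_inv X)| <= #|` V X|.
Proof. by apply: (card_le_image (f := emid X)) => x /sti_VP. Qed.

Lemma card_sti_a1 : #|` a1 (sqrt_tau_inv X)| <= #|` a1 X|.
Proof.
apply: (card_le_image (f := emid X)) => x xa.
have := fsubsetP (C1_a1 (sqrt_tau_inv_C1 hX)) _ xa.
by move=> /sti_VP[u uV e]; exists u => //; rewrite -sti_a1 // -e.
Qed.

Lemma sti_split u v : (u, v) \in E X ->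
  (emid X u \in Defs.split (sqrt_tau_inv X)) = (u \in a1 X) && (v \in b1 X).
Proof.
move=> uv; have [uV _] := C1_edge hX uv.
by rewrite in_fsetI sti_a1 // sti_b1 // (rightP hX uv).
Qed.

End Cycle.

(** * Effect of [Istep] on the numbers of vertices and particles *)

Section Growth.
Local Open Scope fset_scope.
Context {K : Type} (X : graph K) (hX : C1 X).

(** Charges each new vertex to an old one: a merged pair to its left end, the two halves of a split
    vertex to that vertex in two different ways. The bounds on the number of vertices count these
    charges. *)
Lemma IstepV_ports w : w \in V (Istep X) ->
  (exists2 u, u \in V X `\` merger X & w = porta X u) \/
  (exists2 u, u \in Defs.split X & w = nr u).
Proof.
have nr_l u v : (u, v) \in merging X -> u \notin merger X.
  by move=> uv; apply/mergerP => -[w']; exact: mergel_merger uv.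
case/Istep_VP => [wk|u us ->|u us ->|u v uv ->]; [left|left|right|left].
- exists w; last by rewrite porta_kept.
  rewrite in_fsetD (keptV wk) andbT; apply/mergerP => -[u].
  exact: kept_merger.
- exists u; last by rewrite porta_split.
  rewrite in_fsetD (splitV hX us) andbT; apply/mergerP => -[v].
  exact: split_merger.
- by exists u.
- exists u; last by rewrite (porta_merging hX uv).
  by rewrite in_fsetD (nr_l u v) //; have [] := mergingV hX uv.
Qed.

Lemma card_Istep_a1 : #|` a1 (Istep X)| <= #|` a1 X|.
Proof.
apply: (card_le_image (f := porta X)) => w /Istep_a1P[[wk wa]|[u us ->]|].
- by exists w => //; rewrite porta_kept.
- exists u; last by rewrite porta_split.
  by move: us; rewrite in_fsetI => /andP[].
- move=> [u [v [uv ->]]]; exists u; last by rewrite (porta_merging hX uv).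
  by case/mergingP: uv.
Qed.

Lemma card_Istep : #|` V (Istep X)| <= (#|` V X| + #|` a1 X|)%N.
Proof.
have -> : (#|` V X| + #|` a1 X|)%N =
    size (map (porta X) (V X) ++ map (@nr K) (a1 X)).
  by rewrite size_cat !size_map.
apply: uniq_leq_size => [|w /IstepV_ports]; first exact: fset_uniq.
rewrite mem_cat => -[[u + ->]|[u + ->]].
  by rewrite in_fsetD => /andP[_ uV]; rewrite map_f.
by rewrite in_fsetI => /andP[ua _]; rewrite (map_f _ ua) orbT.
Qed.

Lemma Istep_has_a1 : (exists u, u \in a1 X) -> exists u, u \in a1 (Istep X).
Proof.
move=> [u ua]; have uV := fsubsetP (C1_a1 hX) _ ua.
case: (kindP uV) => [uk|us|v uv|v /mergingP[_ _ _ _]]; last by rewrite ua.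
- by exists u; rewrite a1_kept.
- by exists (nl u); exact: a1_nl.
- by exists (vee u v); exact: a1_vee.
Qed.

Lemma Istep_has_b1 : (exists u, u \in b1 X) -> exists u, u \in b1 (Istep X).
Proof.
move=> [u ua]; have uV := fsubsetP (C1_b1 hX) _ ua.
case: (kindP uV) => [uk|us|v /mergingP[_ _ _]|v vu]; last 2 first.
- by rewrite ua.
- by exists (vee v u); exact: b1_vee.
- by exists u; rewrite b1_kept.
- by exists (nr u); exact: b1_nr.
Qed.

Lemma card_Istep_lt : Defs.split X = fset0 -> merging X != fset0 ->
  #|` V (Istep X)| < #|` V X|.
Proof.
move=> s0 /fset0Pn[[u v] uv]; have [uV vV] := mergingV hX uv.
apply: (@leq_ltn_trans #|` V X `\` merger X|).
  apply: (card_le_image (f := porta X)) => w /IstepV_ports[//|[x]].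
  by rewrite s0.
apply: fproper_ltn_card; rewrite fproperE fsubsetDl /=.
apply/fsubsetPn; exists v => //; rewrite in_fsetD negb_and negbK.
by apply/orP; left; apply/mergerP; exists u.
Qed.

Lemma Istep_id : Defs.split X = fset0 -> merging X = fset0 -> Istep X = X.
Proof.
move=> s0 m0; have k0 : kept X = V X.
  by rewrite /kept /mergel /merger s0 m0 !imfset0 !fsetU0 fsetD0.
have pa u : porta X u = u.
  by rewrite /porta /mergel s0 m0 imfset0 !in_fset0.
have pb u : portb X u = u.
  by rewrite /portb /merger s0 m0 imfset0 !in_fset0.
apply: graph_eq => /=; rewrite ?k0 ?s0 ?m0 ?imfset0 ?fsetU0 ?fsetD0 //.
- apply/fsetP => -[u v]; apply/imfsetP/idP => [[[x y] /= xy]|uv].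
    by rewrite pa pb => -[-> ->].
  by exists (u, v) => //=; rewrite pa pb.
- exact/fsetIidPl/C1_a1.
- exact/fsetIidPl/C1_b1.
Qed.

End Growth.

(** * Appearance of a bond *)

Definition has_bond (K : Type) (X : graph K) : Prop :=
  exists u v, [/\ (u, v) \in E X, u \in a1 X & v \in b1 X].

(* Without a bond no vertex splits; then either two vertices merge and the
   graph shrinks, or the next b-particle comes one vertex closer to a given
   a-particle. *)
Lemma bond_appears (K : Type) (X : graph K) : C1 X ->
  (exists u, u \in a1 X) -> (exists v, v \in b1 X) ->
  exists n, has_bond (iter n (@step_inv K) X).
Proof.
have [m] := ubnP #|` V X|%fset; elim: m X => // m IHm X leXm hX [u ua] [v vb].
have uV := fsubsetP (C1_a1 hX) _ ua; have vV := fsubsetP (C1_b1 hX) _ vb.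
(* Counting starts at the right neighbour, so the distance k+1 is positive even if u = v, when the
   walk goes around the cycle. *)
have [k vE] := reach_rneigh hX (rneighV hX uV) vV.
have {v vb vV vE} : iter k.+1 (rneigh X) u \in b1 X by rewrite iterSr vE.
(* Inner induction on the distance, for a fixed bound m on the vertex count; distance 1 is a
   bond. *)
elim: k X u leXm hX uV ua => [|k IHk] X u leXm hX uV ua ub.
  by exists 0, u, (rneigh X u); split=> //; exact: right_edge.
have [bX|nbX] := boolp.pselect (has_bond X); first by exists 0.
suff [n bn] : exists n, has_bond (iter n (@step_inv K) (step_inv X)).
  by exists n.+1; rewrite iterSr.
have hY := sqrt_tau_inv_C1 hX; set Y := sqrt_tau_inv X in hY.
have s0 : Defs.split Y = fset0%fset.
  apply/fsetP => w; rewrite in_fset0; apply/negP => ws.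
  have /(sti_VP hX)[x xV e] := splitV hY ws; apply: nbX.
  exists x, (rneigh X x); have xE := right_edge hX xV.
  by move: ws; rewrite e (sti_split hX xE) => /andP[].
have Ya : emid X u \in a1 Y by rewrite sti_a1.
(* Each of the two particles moved half an edge towards the other, so the distance drops by one. *)
have Yb : iter k.+1 (rneigh Y) (emid X u) \in b1 Y.
  by rewrite sti_iter_rneigh // sti_b1 // iter_rneighV.
have [m0|mN0] := eqVneq (merging Y) fset0%fset.
  rewrite /step_inv -/Y (Istep_id hY s0 m0).
  apply: IHk Yb => //; last exact: (fsubsetP (C1_a1 hY)).
  by apply: leq_ltn_trans leXm; exact: card_sti.
apply: IHm; last 1 first.
- by apply: Istep_has_b1 => //; eexists; exact: Yb.
- apply: (leq_trans (card_Istep_lt hY s0 mN0)).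
  by apply: leq_trans (card_sti hX) _; rewrite -ltnS.
- exact: step_inv_C1.
- by apply: Istep_has_a1 => //; exists (emid X u).
Qed.

(** * Transport of paths and inversions through [Istep] *)

Section Cells.
Context {K : Type} (X : graph K) (hX : C1 X).
Let Y := Istep X.

(* A merged pair is attributed to its left end. *)
Definition cell (u : name K) : seq (name K) :=
  if u \in merger X then [::] else
  if u \in Defs.split X then [:: nl u; nr u] else [:: porta X u].

Definition cells (s : seq (name K)) : seq (name K) := flatten (map cell s).

Lemma cells_cons u s : cells (u :: s) = cell u ++ cells s.
Proof. by []. Qed.

Local Arguments a1 : simpl never.
Local Arguments b1 : simpl never.
Local Arguments cells : simpl never.

(* The last vertex of Istep X built from the vertices up to u. *)
Definition cell_end (u : name K) : name K :=
  if u \in mergel X then porta X u else portb X u.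

Variant cell_spec (u : name K) : seq (name K) -> bool -> bool -> Prop :=
| CKept of u \in kept X : cell_spec u [:: u] false false
| CSplit of u \in Defs.split X : cell_spec u [:: nl u; nr u] false false
| CMergel v of (u, v) \in merging X : cell_spec u [:: vee u v] true false
| CMerger w of (w, u) \in merging X : cell_spec u [::] false true.

Lemma cellP u : u \in V X ->
  cell_spec u (cell u) (u \in mergel X) (u \in merger X).
Proof.
move=> uV; rewrite /cell; case: (kindP uV) => [uk|us|v uv|w wu].
- have -> : (u \in mergel X) = false.
    by apply/mergelP => -[v]; exact: kept_mergel.
  have -> : (u \in merger X) = false.
    by apply/mergerP => -[v]; exact: kept_merger.
  case: ifP => [/(kept_split uk)//|_].
  by rewrite porta_kept //; exact: CKept.
- have -> : (u \in mergel X) = false.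
    by apply/mergelP => -[v]; exact: split_mergel.
  have -> : (u \in merger X) = false.
    by apply/mergerP => -[v]; exact: split_merger.
  by rewrite us; exact: CSplit.
- have -> : u \in mergel X by apply/mergelP; exists v.
  have -> : (u \in merger X) = false.
    by apply/mergerP => -[w]; exact: mergel_merger uv.
  case: ifP => [/split_mergel/(_ uv)//|_].
  by rewrite (porta_merging hX uv); exact: CMergel.
- have -> : u \in merger X by apply/mergerP; exists w.
  have -> : (u \in mergel X) = false.
    by apply/mergelP => -[v uv]; exact: mergel_merger uv wu.
  exact: CMerger wu.
Qed.

Lemma mergel_mergerE u v : (u, v) \in E X ->
  (v \in merger X) = (u \in mergel X).
Proof.
move=> uv; apply/mergerP/mergelP => -[w h].
  by exists v; rewrite (edgea hX uv (merging_E h)).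
by exists u; rewrite (edgeb hX uv (merging_E h)).
Qed.

(** Every w in the cell of z satisfies w.l = z.t for some word t, so w determines z by the name
    condition of [C1]. *)
Lemma cells_uniq s : {subset s <= V X} -> uniq s -> uniq (cells s).
Proof.
move=> sV us; apply: uniq_flatten_map => // [x /sV xV|x y w /sV xV /sV yV].
  case: (cellP xV) => //= _; rewrite inE andbT; apply/eqP.
  exact: (neq_nl_nr hX xV xV).
have cw z : z \in V X -> w \in cell z ->
    exists t, dot w [:: lt_l] = dot z t.
  move=> zV; case: (cellP zV) => [_|_|v _|//]; rewrite !inE.
  - by move=> /eqP->; eexists.
  - by move=> /orP[/eqP->|/eqP->]; rewrite dot_cat; eexists.
  - by move=> /eqP->; rewrite dot_vee_l; eexists.
move=> /(cw _ xV)[t e] /(cw _ yV)[t']; rewrite e => {}e.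
by have [] := C1_names hX xV yV e.
Qed.

(** The cell of the next vertex v starts at the right neighbour of [cell_end u], or is empty when u
    and v merge, and then the end does not move. *)
Lemma cells_path u s : u \in V X -> path (edge X) u s ->
  path (edge Y) (cell_end u) (cells s).
Proof.
elim: s u => //= v s IHs u uV /andP[uv /IHs]; have [_ vV] := C1_edge hX uv.
move=> /(_ vV); rewrite cells_cons cat_path; set p := path _ _ _ => pv.
suff [h1 h2] : path (edge Y) (cell_end u) (cell v) /\
    last (cell_end u) (cell v) = cell_end v by rewrite h1 h2.
have [uvM|uvM] := boolP ((u, v) \in merging X).
  have ul : u \in mergel X by apply/mergelP; exists v.
  have vr : v \in merger X by rewrite (mergel_mergerE uv).
  rewrite /cell vr /cell_end ul; case: mergelP => [[w]|_] /=.
    by move=> /mergel_merger/(_ uvM).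
  by rewrite (porta_merging hX uvM) (portb_merging hX uvM).
have /negbTE ul := nonmergel hX uv uvM.
have e : edge Y (cell_end u) (porta X v).
  by rewrite /cell_end ul; exact: Istep_E_old.
move: (cell_end u) e (mergel_mergerE uv) => x; rewrite ul /cell_end.
case: (cellP vV) => [vk|vs|w vw|//] e _ /=.
- by rewrite -{1}(porta_kept vk) e portb_kept.
- by rewrite -{1}(porta_split vs) e portb_split // /edge Istep_E_split.
- by rewrite -{1}(porta_merging hX vw) e (porta_merging hX vw).
Qed.

(** A merge moves the b-particle of the right end into the cell of the left end. The Boolean term
    corrects for a left end u lying outside s, and the condition on [last u s] prevents a pair from
    being cut at the other extremity. *)
Lemma cells_count_b1 u s : u \in V X -> path (edge X) u s ->
  last u s \notin mergel X ->
  count (mem (b1 Y)) (cells s) + (u \in mergel X) = count (mem (b1 X)) s.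
Proof.
elim: s u => [|v s IHs] u uV /=; first by move=> _ /negbTE->.
move=> /andP[uv pv] sl; have [_ vV] := C1_edge hX uv.
have {IHs pv sl} := IHs v vV pv sl; rewrite -(mergel_mergerE uv).
rewrite cells_cons count_cat; case: (cellP vV) => [vk|vs|w vw|w wv] /= <-.
- by rewrite b1_kept // !addn0.
- have /andP[_ ->] : (v \in a1 X) && (v \in b1 X) by rewrite -in_fsetI.
  by rewrite (negbTE (b1_nl hX vs)) b1_nr // !addn0.
- by case/mergingP: (vw) => _ _ _ /negbTE-> _; rewrite b1_vee // !addn0 addnC.
- by case/mergingP: wv => _ _ -> _ _; rewrite addn0 addnC.
Qed.

(** Size minus inversions does not drop. A merge loses one vertex and the inversion inside the pair;
    a split gains one vertex and turns a weak inversion i = i into a strict one; a kept vertex never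
    carries both particles. The slack is the number of splits. *)
Lemma cells_inv u s : u \in V X -> path (edge X) u s ->
  last u s \notin mergel X ->
  size s + inv_lt (mem (a1 Y)) (mem (b1 Y)) (cells s) <=
  size (cells s) + inv_le (mem (a1 X)) (mem (b1 X)) s + (u \in mergel X).
Proof.
elim: s u => [|v s IHs] u uV //= /andP[uv pv] sl.
have [_ vV] := C1_edge hX uv.
have := cells_count_b1 vV pv sl.
have {IHs pv sl} := IHs v vV pv sl; rewrite -(mergel_mergerE uv).
rewrite cells_cons size_cat.
case: (cellP vV) => [vk|vs|w vw|w wv] /= IH <-.
- have : ~~ ((v \in a1 X) && (v \in b1 X)).
    by rewrite -in_fsetI; apply/negP => vs; exact: kept_split vk vs.
  rewrite a1_kept //; case: (v \in a1 X); case: (v \in b1 X) => //= _; lia.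
- have /andP[-> ->] : (v \in a1 X) && (v \in b1 X) by rewrite -in_fsetI.
  rewrite (negbTE (a1_nr hX vs)) a1_nl // b1_nr //=; lia.
- case/mergingP: (vw) => _ -> _ /negbTE-> _; rewrite a1_vee //; lia.
- by case/mergingP: wv => _ _ _ _ /negbTE->; lia.
Qed.

End Cells.

Lemma iter_step_inv_C1 (K : Type) (X : graph K) n :
  C1 X -> C1 (iter n (@step_inv K) X).
Proof. by move=> hX; elim: n => //= n; exact: step_inv_C1. Qed.

(** * Growth of the cycle cut at a bond *)

Section BondedCycle.
Context {K : Type}.
Local Arguments a1 : simpl never.
Local Arguments b1 : simpl never.

(* The whole graph as a list cut at a bond. The bond persists forever, so the
   particles on its two sides never meet across it. *)
Definition bonded_cycle (X : graph K) (x : name K) (s : seq (name K)) : Prop :=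
  [/\ uniq (x :: s), cycle (edge X) (x :: s), x \in b1 X & last x s \in a1 X].

Lemma has_bond_cycle (X : graph K) : C1 X -> has_bond X ->
  exists x s, bonded_cycle X x s.
Proof.
move=> hX [u [v [uv ua vb]]]; have [_ vV] := C1_edge hX uv.
have [s [us cs]] := vertex_cycle hX vV; exists v, s; split=> //.
rewrite -(edgea hX uv (u' := last v s)) //.
by move: cs; rewrite /= rcons_path => /andP[].
Qed.

Definition inversions (X : graph K) : seq (name K) -> nat :=
  inv_lt (mem (a1 X)) (mem (b1 X)).

(** An a-particle at position i goes to edge i and a b-particle at position j to edge j-1, so i < j
    becomes i <= j-1. *)
Lemma sti_inversions (X : graph K) x s : C1 X -> x \in V X ->
  path (edge X) x s ->
  let Y := sqrt_tau_inv X in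
  let ys := map (emid X) (belast x s) in
  count (mem (b1 Y)) ys = count (mem (b1 X)) s /\
  inv_le (mem (a1 Y)) (mem (b1 Y)) ys = inversions X (x :: s).
Proof.
move=> hX; elim: s x => [|y s IHs] x xV; first by rewrite /inversions /= muln0.
move=> /= /andP[xy ys]; have [_ yV] := C1_edge hX xy.
have [-> ->] := IHs y yV ys.
by rewrite sti_a1 // sti_b1 // (rightP hX xy).
Qed.

(* A merge removes exactly one inversion, a split creates none, and the bond
   contributes one new vertex. *)
Lemma bonded_cycle_step (X : graph K) x s : C1 X -> bonded_cycle X x s ->
  exists x' s', bonded_cycle (step_inv X) x' s' /\
    (size s).+1 + inversions (step_inv X) (x' :: s') <=
    size s' + inversions X (x :: s).
Proof.
move=> hX [us cs xb la]; have hY := sqrt_tau_inv_C1 hX.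
have sV := cycleV hX cs; have xV : x \in V X by rewrite sV ?mem_head.
have lV : last x s \in V X by rewrite sV ?mem_last.
have [ps lx] : path (edge X) x s /\ edge X (last x s) x.
  by move: cs; rewrite /= rcons_path => /andP[].
have [_] := sti_inversions hX xV ps.
set Y := sqrt_tau_inv X in hY *; set ys := map _ _ => inv_ys.
(* The vertex where the two particles of the bond meet. *)
pose z := emid X (last x s).
have ysz : rcons ys z = map (emid X) (x :: s) by rewrite lastI map_rcons.
have cz : cycle (edge Y) (z :: ys).
  rewrite -(rotr1_rcons z ys) rotr_cycle ysz cycle_map.
  apply: sub_cycle cs => u v uv /=; rewrite -(rightP hX uv).
  by apply: sti_edge => //; have [] := C1_edge hX uv.
have zs : z \in Defs.split Y by rewrite (sti_split hX lx) la xb.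
have zV := splitV hY zs.
have [ez zl zr] : [/\ cell Y z = [:: nl z; nr z], z \notin mergel Y &
    z \notin merger Y].
  case: (cellP hY zV) (zs) => [/kept_split h /h|_|w h /split_mergel/(_ h)|] //.
  by move=> w h /split_merger/(_ h).
have cellsz : cells Y (rcons ys z) = rcons (rcons (cells Y ys) (nl z)) (nr z).
  by rewrite /cells map_rcons flatten_rcons ez -!cats1 -catA.
(* The split of z recreates the bond as the edge from [nl z] to [nr z], where the new list is
   cut. *)
exists (nr z), (rcons (cells Y ys) (nl z)); split; first split.
- rewrite cons_uniq -rcons_uniq -cellsz; apply: cells_uniq => //.
    move=> w; rewrite mem_rcons; exact: cycleV.
  rewrite ysz map_inj_in_uniq // => u v /sV uV /sV vV; exact: emid_inj.
- have := cells_path hY zV cz; rewrite cellsz /cell_end (negbTE zl).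
  by rewrite portb_split.
- exact: b1_nr.
- by rewrite last_rcons a1_nl.
have /andP[pz lz] : path (edge Y) z ys && edge Y (last z ys) z.
  by rewrite -rcons_path.
have := cells_inv hY zV pz; rewrite -(mergel_mergerE hY lz) (negbTE zl) inv_ys.
move=> /(_ zr); rewrite addn0 size_map size_belast size_rcons !addSn ltnS.
(* The head [nr z] has no a-particle and the last vertex [nl z] no b-particle, so neither takes part
   in an inversion. *)
rewrite {2}/inversions inv_lt_cons; last exact: (a1_nr hY zs).
by rewrite inv_lt_rcons //; exact: b1_nl.
Qed.

(** Size minus inversions gains at least one per step, and inversions are nonnegative, so the total
    loss is at most their initial number. *)
Lemma bonded_cycle_growth (X : graph K) x s n : C1 X -> bonded_cycle X x s ->
  n <= #|` V (iter n (@step_inv K) X)|%fset + inversions X (x :: s).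
Proof.
move=> hX bX; have hn n := iter_step_inv_C1 n hX.
suff [y [t [[ut ct _ _] le_n]]] : exists y t,
    bonded_cycle (iter n (@step_inv K) X) y t /\
    n + inversions (iter n (@step_inv K) X) (y :: t) <=
    size t + inversions X (x :: s).
  apply: leq_trans (leq_addr _ n) (leq_trans le_n _); rewrite leq_add2r.
  exact: ltnW (uniq_leq_size ut (cycleV (hn n) ct)).
elim: n => [|n [y [t [bn le_n]]]].
  by exists x, s; split=> //; rewrite leq_addl.
have [y' [t' [bn' le']]] := bonded_cycle_step (hn n) bn.
exists y', t'; split=> //; move: le_n le'; rewrite iterS.
move: (inversions _ (y :: t)) (inversions _ (y' :: t')) (inversions X _).
lia.
Qed.

End BondedCycle.

(** * Linear upper bound and conclusion *)

Lemma card_iter_step_inv (K : Type) (X : graph K) n : C1 X ->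
  #|` V (iter n (@step_inv K) X)|%fset <=
  #|` V X|%fset + n * #|` a1 X|%fset.
Proof.
move=> hX; suff : #|` a1 (iter n (@step_inv K) X)|%fset <= #|` a1 X|%fset /\
    #|` V (iter n (@step_inv K) X)|%fset <= #|` V X|%fset + n * #|` a1 X|%fset.
  by case.
elim: n => [|n [IHa IHV]]; first by rewrite mul0n addn0.
have hn := iter_step_inv_C1 n hX; have hY := sqrt_tau_inv_C1 hn.
have ha := card_sti_a1 hn; split=> /=.
  exact: leq_trans (card_Istep_a1 hY) (leq_trans ha IHa).
apply: leq_trans (card_Istep hY) _; rewrite mulSn addnCA addnC.
by apply: leq_add; [exact: leq_trans ha IHa|exact: leq_trans (card_sti hn) IHV].
Qed.

Import GRing.Theory Num.Theory.

Theorem theorem3 (R : realType) (K : countType) (X : graph K) (hX : C1 X)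
    (ha : exists2 u, u \in V X & u \in a1 X)
    (hb : exists2 v, v \in V X & v \in b1 X) :
  Theta (fun n : nat => (#|` V (iter n (@step_inv K) X)|%fset%:R : R)%R)
        (fun n : nat => (n%:R : R)%R).
Proof.
have [n0 bond] : exists n, has_bond (iter n (@step_inv K) X).
  by apply: bond_appears => //; [case: ha|case: hb] => u _; exists u.
have hn0 := iter_step_inv_C1 n0 hX.
have [x [s bX]] := has_bond_cycle hn0 bond.
set I0 := inversions (iter n0 (@step_inv K) X) (x :: s).
pose c := #|` V X|%fset + #|` a1 X|%fset.
(* The count is at least n - n0 - I0, hence at least n/2 once n >= 2(n0 + I0). The successor in the
   threshold gives n >= 1, so that c n absorbs the constant term of the upper bound. *)
exists (2^-1)%R, (c.+1%:R)%R, (2 * (n0 + I0)).+1; split=> [||n le_n].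
- by rewrite invr_gt0 ltr0n.
- by rewrite ltr0n.
have lower : n <= 2 * #|` V (iter n (@step_inv K) X)|%fset.
  have := bonded_cycle_growth (n - n0) hn0 bX.
  rewrite -iterD subnK -/I0; lia.
have upper : #|` V (iter n (@step_inv K) X)|%fset <= c.+1 * n.
  apply: leq_trans (card_iter_step_inv n hX) _; rewrite /c; nia.
apply/andP; split; last by rewrite -natrM ler_nat.
by rewrite mulrC ler_pdivrMr ?ltr0n // -natrM ler_nat mulnC.
Qed.
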